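(* Let $t_1,\dots,t_k$ be integers with $1\le t_i\le m$ for all $i$. Then the multi-homogeneous Rees algebra $\operatorname{Rees}(I_{t_1},\dots,I_{t_k})$ is defined by a Gröbner basis of quadrics; that is, the kernel of the natural presentation $$\mathbb{K}[x_1,\dots,x_n][Y_{(j,a)}:(j,a)\in A]\to \operatorname{Rees}(I_{t_1},\dots,I_{t_k}),\qquad x_i\mapsto x_i,\quad Y_{(j,a)}\mapsto M(a)\,T_j,$$ has, with respect to some term order, a Gröbner basis consisting of homogeneous polynomials of degree $2$ (where all the variables $x_i$ and $Y_{(j,a)}$ have degree $1$).
   Context: Let $\mathbb{K}$ be a field, let $n\ge 1$ and $c\geq 1$ be integers, and let $R=\mathbb{K}[x_1,\dots,x_n]$. Set $m=\lfloor \frac{n+c}{c+1}\rfloor$. For $1\le t\le m$ let $X_t$ be the $t\times (n-(t-1)c)$ matrix whose $(i,j)$ entry is $x_{j+(i-1)c}$, and let $I_t\subset R$ be the ideal generated by all $t$-minors of $X_t$. A sequence of integers $a=(a_1,\dots,a_t)$ in $\{1,\dots,n\}$ is a $c$-chain (of length $t$) if $a_i+c<a_{i+1}$ for all $i=1,\dots,t-1$. For a $c$-chain $a=(a_1,\dots,a_t)$, $M(a)$ denotes the $t$-minor of $X_t$ whose main diagonal entries are $x_{a_1},\dots,x_{a_t}$, i.e. the minor of $X_t$ with columns $a_1,\,a_2-(c+1),\,\dots,\,a_t-(t-1)(c+1)$; these are exactly the maximal minors of $X_t$. Let $A=\{(j,a): 1\le j\le k,\ a \text{ a } c\text{-chain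 of length } t_j\}$. For ideals $L_1,\dots,L_k$ of $R$, the multi-homogeneous Rees algebra is the $R$-subalgebra of $R[T_1,\dots,T_k]$ given by $\operatorname{Rees}(L_1,\dots,L_k)=\bigoplus_{(\alpha_1,\dots,\alpha_k)\in\mathbb{N}^k}(L_1T_1)^{\alpha_1}\cdots(L_kT_k)^{\alpha_k}$.
   Formalization: M(a) is the t-minor with main diagonal x_{a_1},…,x_{a_t}, so its columns are a_i-(i-1)c; the stated columns a_i-(i-1)(c+1) contradict this (for c=1, a=(1,3) they give column 1 twice, hence minor 0, not x_1x_3-x_2^2). *)

(* Defs.v *)
From mathcomp Require Import all_boot all_order all_algebra.
From mathcomp Require Import mpoly.

Set Implicit Arguments.
Unset Strict Implicit.
Unset Printing Implicit Defensive.

Import GRing.Theory.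
Local Open Scope ring_scope.

Section Ideals.
Variable R : comNzRingType.
Implicit Types (I J S : R -> Prop).

Definition ideal_gen S : R -> Prop := fun p =>
  exists s : seq (R * R),
    (forall u, u \in s -> S u.2) /\ p = \sum_(u <- s) u.1 * u.2.

Definition ideal_one : R -> Prop := fun _ => True.

Definition ideal_mul I J : R -> Prop :=
  ideal_gen (fun p => exists a b, [/\ I a, J b & p = a * b]).

Definition ideal_exp I (d : nat) : R -> Prop := iter d (ideal_mul I) ideal_one.

Definition is_minor (r p q : nat) (M : 'M[R]_(p, q)) : R -> Prop := fun d =>
  exists (f : 'I_r -> 'I_p) (g : 'I_r -> 'I_q),
    [/\ {homo f : i j / (i < j)%N}, {homo g : i j / (i < j)%N}
      & d = \det (mxsub f g M)].

(* The homogeneous component of multidegree alpha of the direct sum defining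
   Rees(L_1, ..., L_k) is (L_1^alpha_1 ... L_k^alpha_k) T^alpha. *)
Definition rees (k : nat) (L : 'I_k -> R -> Prop) : {mpoly R[k]} -> Prop :=
  fun f => forall alpha : 'X_{1..k},
    (\big[ideal_mul/ideal_one]_(j < k) ideal_exp (L j) (alpha j)) f@_alpha.

End Ideals.

Section Groebner.
Variables (K : fieldType) (N : nat).

(* Well-foundedness follows from these axioms by Dickson's lemma. *)
Definition term_order (le : rel 'X_{1..N}) : Prop :=
  [/\ [/\ reflexive le, antisymmetric le, transitive le & total le],
      forall u, le 0%MM u
    & forall u v w, le u v -> le (u + w)%MM (v + w)%MM].

Definition is_lead (le : rel 'X_{1..N}) (f : {mpoly K[N]}) (u : 'X_{1..N}) :=
  u \in msupp f /\ {in msupp f, forall v, le v u}.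

Definition initial_ideal (le : rel 'X_{1..N}) (S : {mpoly K[N]} -> Prop) :
    {mpoly K[N]} -> Prop :=
  ideal_gen (fun p => exists f u, [/\ S f, is_lead le f u & p = 'X_[u]]).

Definition groebner_basis (le : rel 'X_{1..N}) (I : {mpoly K[N]} -> Prop)
    (G : seq {mpoly K[N]}) : Prop :=
  [/\ forall g, g \in G -> g != 0,
      forall g, g \in G -> I g
    & forall p, initial_ideal le I p <-> initial_ideal le (fun g => g \in G) p].

End Groebner.

(* All indices are 0-based: x_1, ..., x_n are 'X_0, ..., 'X_(n-1), and the
   (i, j) entry of X_t (cat_mx below) is the variable of index j + i * c. *)

Lemma catalecticant_subproof (n c t : nat) (i : 'I_t) (j : 'I_(n - t.-1 * c)) :
  (j + i * c < n)%N.
Proof.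
have hi : (i * c <= t.-1 * c)%N.
  by rewrite leq_mul2r -ltnS (ltn_predK (ltn_ord i)) ltn_ord orbT.
have := ltn_ord j; rewrite ltn_subRL addnC; apply: leq_trans.
by rewrite ltnS leq_add2l.
Qed.

Definition cat_mx (K : fieldType) (n c t : nat) :
    'M[{mpoly K[n]}]_(t, n - t.-1 * c) :=
  \matrix_(i < t, j < n - t.-1 * c) 'X_(Ordinal (catalecticant_subproof i j)).

Definition minor_ideal (K : fieldType) (n c t : nat) : {mpoly K[n]} -> Prop :=
  ideal_gen (is_minor t (cat_mx K n c t)).

Definition is_cchain (n c t : nat) (a : t.-tuple 'I_n) : bool :=
  sorted (fun x y : 'I_n => x + c < y)%N a.

Definition cchain (n c t : nat) := {a : t.-tuple 'I_n | is_cchain c a}.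

Lemma cchain_leq (n c t : nat) (a : cchain n c t) (i j : 'I_t) :
  (i < j)%N -> (tnth (val a) i + (j - i) * c < tnth (val a) j)%N.
Proof.
case: a => a /= ha; case: i => i hi; case: j => j hj /=.
have [x0 _] : exists x0 : 'I_n, True by exists (tnth a (Ordinal hi)).
rewrite !(tnth_nth x0) /=.
elim: j hj => // j IH hj; rewrite ltnS leq_eqVlt => hij.
have step : (nth x0 a j + c < nth x0 a j.+1)%N.
  by move/(sortedP x0): ha; apply; rewrite size_tuple.
case/orP: hij => [/eqP -> | hij]; first by rewrite subSnn mul1n.
apply: (leq_ltn_trans _ step); rewrite (subSn (ltnW hij)) mulSn addnCA [leqLHS]addnC.
by rewrite leq_add2r; apply: ltnW; apply: IH (ltnW hj) hij.
Qed.

Lemma cchain_geq (n c t : nat) (a : cchain n c t) (i : 'I_t) :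
  (i * c <= tnth (val a) i)%N.
Proof.
have h0 : (0 < t)%N by apply: leq_ltn_trans (ltn_ord i).
have [/eqP -> //|i0] := boolP (i == 0 :> nat)%N.
have := @cchain_leq n c t a (Ordinal h0) i; rewrite /= lt0n subn0 => /(_ i0) h.
by apply: leq_trans (ltnW h); rewrite leq_addl.
Qed.

Lemma chain_col_subproof (n c t : nat) (a : cchain n c t) (i : 'I_t) :
  (tnth (val a) i - i * c < n - t.-1 * c)%N.
Proof.
have t0 : (t.-1 < t)%N by rewrite (ltn_predK (ltn_ord i)).
have hit : (i <= t.-1)%N by rewrite -ltnS (ltn_predK (ltn_ord i)).
have hl : (tnth (val a) i + (t.-1 - i) * c <= tnth (val a) (Ordinal t0))%N.
  move: hit; rewrite leq_eqVlt => /orP[/eqP e|h].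
    by rewrite (_ : Ordinal t0 = i) ?e ?subnn ?addn0 //; apply: val_inj.
  exact/ltnW/(@cchain_leq _ _ _ a i (Ordinal t0)).
rewrite ltn_subRL -{1}(subnK hit) mulnDl -addnA subnKC ?cchain_geq // addnC.
exact: leq_ltn_trans hl (ltn_ord _).
Qed.

(* In 1-based terms the (i, j) entry of X_t is x_{j+(i-1)c}, so the diagonal
   entry x_{a_i} lies in column a_i - (i-1)c; see chain_minor_diag. *)
Definition chain_col (n c t : nat) (a : cchain n c t) (i : 'I_t) :
    'I_(n - t.-1 * c) := Ordinal (chain_col_subproof a i).

Definition chain_minor (K : fieldType) (n c t : nat) (a : cchain n c t) :
    {mpoly K[n]} := \det (colsub (chain_col a) (cat_mx K n c t)).

Lemma chain_minor_diag (K : fieldType) (n c t : nat) (a : cchain n c t)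
    (i : 'I_t) :
  colsub (chain_col a) (cat_mx K n c t) i i = 'X_(tnth (val a) i).
Proof.
rewrite !mxE; congr ('X_[U_(_)]%MM); apply: val_inj => /=.
by rewrite subnK // cchain_geq.
Qed.

Definition rees_idx (n c k : nat) (t : 'I_k -> nat) :=
  {j : 'I_k & cchain n c (t j)}.

Definition rees_nvars (n c k : nat) (t : 'I_k -> nat) : nat :=
  n + #|{: rees_idx n c t}|.

(* The polynomial ring K[x_1, ..., x_n][Y_(j,a)] is {mpoly K[rees_nvars]}: the
   first n variables are the x_i, the others are the Y_(j,a), enumerated through
   enum_val. Its target R[T_1, ..., T_k] is {mpoly {mpoly K[n]}[k]}. *)
Definition rees_var (K : fieldType) (n c k : nat) (t : 'I_k -> nat)
    (v : 'I_(rees_nvars n c t)) : {mpoly {mpoly K[n]}[k]} :=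
  match split (v : 'I_(n + #|{: rees_idx n c t}|)) with
  | inl i => ('X_i)%:MP
  | inr r => let ja := enum_val r in
             (chain_minor K (tagged ja))%:MP * 'X_(tag ja)
  end.

Definition rees_pres (K : fieldType) (n c k : nat) (t : 'I_k -> nat)
    (p : {mpoly K[rees_nvars n c t]}) : {mpoly {mpoly K[n]}[k]} :=
  mmap (fun a : K => (a%:MP_[n])%:MP_[k]) (@rees_var K n c k t) p.

(* Main.v *)
(* SAGBI degeneration. For the order in which [x_1 > ... > x_n], the leading
   monomial of the minor [M(a)] is [x_(a_1) ... x_(a_t)]. Map a monomial [u] in the
   [x_i] and [Y_(j,a)] to the leading monomial [mu u] of its image, order monomials
   by [mu] first, and break ties by a weight. Two facts give a quadratic basis.

   - Toric part. A chain [a] is encoded by its counting function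
     [f x = #{i | a_i < x}]; chains are cut out by difference constraints, so the
     prefixes of [f] and [g] may be replaced by [max (f, g - th)] and
     [min (g, f + th)]. A monomial none of whose pairs of variables can be improved
     in this way is determined by its content and its multidegree.
   - Lifting. A nonzero combination [h] of products [M(a) M(b)], with lengths
     [s <= t], has a leading monomial of the same shape. Substitute
     [x_i + y_i] for [x_i], where [y] is a generic point of the scroll on which
     [X_t] has rank one. Minors become affine linear, so a window of
     length [c + 1] contains at most two elements of the leading monomial, and
     [t]-minors go to [(t-1)]-minors, so that it contains a chain of length [t]. *)
From HB Require Import structures.
Require Import Defs.
From mathcomp Require Import all_boot all_order all_algebra perm zify.
From mathcomp Require Import mpoly.

Set Implicit Arguments.
Unset Strict Implicit.
Unset Printing Implicit Defensive.

Import Order.TTheory GRing.Theory.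
Local Open Scope ring_scope.

(** * Chains as counting functions *)

(** Degree two suffices by a normal form argument. A monomial is standard if no quadratic divisor
    can be improved. Standard monomials span modulo the kernel, and two of them with the same
    [T]-degree have different initial monomials, so the leading monomial of a kernel element is
    never standard.

    The obstacle is cancellation: when the leading terms of products of two minors cancel, nothing
    is known about the next term. The proof therefore never follows individual terms. It uses only
    conditions stable under linear combinations: membership in the ideal of minors of the longer
    size, degree at most two in the shift parameters, and homogeneity. These three already force the
    leading monomial to split into two chains of the right lengths.

    In the toric part the exchanges are of three kinds: at different heights, at equal height
    between different classes, and within a class. Each kind has its own strictly decreasing weight.
    A weight is a sum over single variables, hence additive on monomials, and so may be used to
    define a term order. *)

Section CountingFunctions.
Local Open Scope nat_scope.
Variables (c n : nat).

Definition chainf (T : nat) (f : nat -> nat) :=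
  [/\ f 0 = 0, forall x, f x <= f x.+1, forall x, f (x + c.+1) <= (f x).+1
    & forall x, n <= x -> f x = T].

Lemma chainf_mono T f x y : chainf T f -> x <= y -> f x <= f y.
Proof.
case=> _ h _ _; elim: y => [|y IH]; first by rewrite leqn0 => /eqP ->.
by rewrite leq_eqVlt => /orP[/eqP -> //|/IH]; move: (h y); lia.
Qed.

Lemma chainf_le T f x : chainf T f -> f x <= T.
Proof.
move=> hf; have [_ _ _ e] := hf.
have [/e -> //|] := leqP n x.
by move=> h; rewrite -(e n) //; apply: (chainf_mono hf); lia.
Qed.

Lemma chainf_step T f x : chainf T f -> f x.+1 <= (f x).+1.
Proof.
move=> hf; have [_ _ h _] := hf.
by apply: leq_trans (h x); apply: (chainf_mono hf); lia.
Qed.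

Definition raise th E (f g : nat -> nat) x :=
  if x < E then maxn (f x) (g x - th) else f x.
Definition lower th E (f g : nat -> nat) x :=
  if x < E then minn (g x) (f x + th) else g x.

Lemma raise_lower th E f g x : raise th E f g x + lower th E f g x = f x + g x.
Proof. by rewrite /raise /lower; case: ifP; lia. Qed.

Section Exchange.
Variables (S T th E : nat) (f g : nat -> nat).
Hypotheses (hf : chainf S f) (hg : chainf T g) (E_gt0 : 0 < E).
Hypothesis gap : forall x, E <= x <= E + c -> g x = f x + th.

(** A chain condition compares [x] with [x + c.+1]. If these lie on different sides of the cut [E],
    then [x + c.+1] falls in [[E, E + c]], where [gap] makes the maximum equal to [f] (and, for
    [lower], the minimum equal to [g]). So the condition does not notice the cut. *)
Lemma chainf_raise : chainf S (raise th E f g).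
Proof.
have [f0 f1 f2 f3] := hf; have [g0 g1 g2 g3] := hg.
split=> [|x|x|x hx]; rewrite /raise.
- by rewrite E_gt0 f0 g0; lia.
- have := (f1 x, g1 x); case: ifP => h1; case: ifP => h2 [*];
    have := gap (x := x.+1); lia.
- have := (f2 x, g2 x); case: ifP => h1; case: ifP => h2 [*];
    have := gap (x := x + c.+1); lia.
- case: ifP => h; last exact: f3.
  have := f3 E; have := g3 E; have := gap (x := E); have := f3 x; have := g3 x.
  by lia.
Qed.

Lemma chainf_lower : chainf T (lower th E f g).
Proof.
have [f0 f1 f2 f3] := hf; have [g0 g1 g2 g3] := hg.
split=> [|x|x|x hx]; rewrite /lower.
- by rewrite E_gt0 f0 g0; lia.
- have := (f1 x, g1 x); case: ifP => h1; case: ifP => h2 [*];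
    have := gap (x := x.+1); lia.
- have := (f2 x, g2 x); case: ifP => h1; case: ifP => h2 [*];
    have := gap (x := x + c.+1); lia.
- case: ifP => h; last exact: g3.
  have := f3 E; have := g3 E; have := gap (x := E); have := f3 x; have := g3 x.
  by lia.
Qed.

End Exchange.

(* [maxn f (g - th)] and [minn g (f + th)] stay counting functions because
   the chain conditions are difference constraints. *)
Lemma chainf_split S T f g s t : chainf S f -> chainf T g ->
  S <= s <= t -> t <= T -> s + t = S + T ->
  exists f' g', [/\ chainf s f', chainf t g' & forall x, f' x + g' x = f x + g x].
Proof.
move=> hf hg hst htT e.
have [f0 f1 f2 f3] := hf; have [g0 g1 g2 g3] := hg.
(* The offset is dictated by the values at [n]: the maximum of [S] and [T - (T - s)] is [s], and the
   minimum of [T] and [S + (T - s)] is [t]. *)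
exists (fun x => maxn (f x) (g x - (T - s))), (fun x => minn (g x) (f x + (T - s))).
split=> [||x]; last by lia.
- split=> [|x|x|x hx]; first by rewrite f0 g0; lia.
  + by have := (f1 x, g1 x) => -[*]; lia.
  + by have := (f2 x, g2 x) => -[*]; lia.
  + by rewrite f3 // g3 //; lia.
- split=> [|x|x|x hx]; first by rewrite f0 g0; lia.
  + by have := (f1 x, g1 x) => -[*]; lia.
  + by have := (f2 x, g2 x) => -[*]; lia.
  + by rewrite f3 // g3 //; lia.
Qed.

(* [p] counts a multiset with at most two elements in every window of length
   [c + 1]; [v] counts a greedily chosen chain in it. *)
Lemma greedy_complement (p v : nat -> nat) T :
  chainf T v -> p 0 = 0 ->
  (forall x, v x.+1 - v x <= p x.+1 - p x) -> (forall x, p x <= p x.+1) ->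
  (forall x, p (x + c.+1) <= p x + 2) ->
  (forall x, p x < p x.+1 -> v (x - c) < v x.+1) ->
  (forall x, n <= x -> p x = p n) ->
  chainf (p n - T) (fun x => p x - v x).
Proof.
move=> hv p0 sub p1 p2 gr p3.
have [v0 v1 v2 v3] := hv.
have pmono x y : x <= y -> p x <= p y.
  elim: y => [|y IH]; first by rewrite leqn0 => /eqP ->.
  by rewrite leq_eqVlt => /orP[/eqP -> //|/IH]; move: (p1 y); lia.
have vmono x y : x <= y -> v x <= v y by apply: (chainf_mono hv).
have diff x y : x <= y -> v y - v x <= p y - p x.
  elim: y => [|y IH]; first by rewrite leqn0 => /eqP ->; rewrite !subnn.
  rewrite leq_eqVlt => /orP[/eqP -> |]; first by rewrite !subnn.
  rewrite ltnS => h; have := IH h; have := sub y; have := p1 y; have := v1 y.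
  by have := pmono _ _ h; have := vmono _ _ h; lia.
have vp x : v x <= p x by have := diff 0 x; rewrite v0 p0 !subn0; apply.
split=> [|x|x|x hx]; first by rewrite v0 p0.
- by have := sub x; have := p1 x; have := v1 x; have := vp x; have := vp x.+1; lia.
- have := diff x (x + c.+1); have := p2 x; have := vmono x (x + c.+1).
  have := pmono x (x + c.+1); have := vp x; have := vp (x + c.+1).
  move=> h1 h2 h3 h4 h5 h6.
  have [hle|hgt] := leqP (p (x + c.+1)) (p x + 1 + (v (x + c.+1) - v x)); first lia.
  have ep : p (x + c.+1) = p x + 2 by lia.
  have ev : v (x + c.+1) = v x by lia.
  (* [y] is the last element of a window that has two elements but no chosen one. By greediness a
     chosen element lies in [[y - c, y]], hence before [x], which would give this window three
     elements. *)
  have [y [hy1 hy2 hy3 hy4]] :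
      exists y, [/\ x <= y, y < x + c.+1, p y < p y.+1 & p y.+1 = p (x + c.+1)].
    have : p x < p (x + c.+1) by lia.
    elim: (c.+1) => [|m IH]; first by rewrite addn0 ltnn.
    rewrite addnS => hm; have := p1 (x + m).
    rewrite leq_eqVlt => /orP[/eqP e|h].
      rewrite -e in hm *; have [y [? ? ? ?]] := IH hm; exists y; split; lia.
    by exists (x + m); split; lia.
  have g := gr y hy3.
  have v_y : v y.+1 <= v (x + c.+1) by apply: vmono; lia.
  have d := diff (y - c) x; have hyx : y - c <= x by lia.
  have := d hyx; have := vmono _ _ hyx; have := pmono _ _ hyx.
  have : p y.+1 <= p (y - c) + 2.
    have [hyc|hyc] := leqP c y.
      by have := p2 (y - c); rewrite (_ : y - c + c.+1 = y.+1); [|lia].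
    have := p2 0; rewrite p0 add0n.
    by have := pmono y.+1 c.+1; lia.
  by lia.
- by rewrite (p3 x hx) v3.
Qed.

End CountingFunctions.

(** * Term orders and lifting from degree two *)

Section RefineOrder.
Context (disp : Order.disp_t) (T : orderType disp) (N : nat).
Variables (key : 'X_{1..N} -> T) (le : rel 'X_{1..N}).

Definition refine_order : rel 'X_{1..N} := fun u v =>
  (key u < key v)%O || ((key u == key v) && le u v).

Lemma refine_order_key u v : refine_order u v -> (key u <= key v)%O.
Proof. by case/orP=> [/ltW //|/andP[/eqP ->]]. Qed.

Lemma refine_order_lt u v : (key u < key v)%O -> refine_order u v.
Proof. by rewrite /refine_order => ->. Qed.

Lemma refine_order_eq u v : key u = key v -> refine_order u v = le u v.
Proof. by rewrite /refine_order => ->; rewrite ltxx eqxx. Qed.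

Lemma refine_term_order : term_order le -> (forall u, (key 0%MM <= key u)%O) ->
  (forall w u v, (key (u + w)%MM < key (v + w)%MM)%O = (key u < key v)%O) ->
  term_order refine_order.
Proof.
move=> [[rf an tr tot] le0 lea] key0 keyD.
have keyE w u v : key u = key v -> key (u + w)%MM = key (v + w)%MM.
  by move=> e; apply/eqP; rewrite eq_le !leNgt !keyD e ltxx.
split.
- split=> [u|u v|v u w|u v]; rewrite /refine_order.
  + by rewrite eqxx rf orbT.
  + case: ltgtP => //= e; by rewrite ?andbF // => /an.
  + case: (ltgtP (key u) (key v)) => // [h _|e h].
      by case/orP=> [h'|/andP[/eqP <- _]]; rewrite ?h // (lt_trans h h').
    rewrite e; case/orP=> [-> //|/andP[-> h']]; rewrite (tr _ _ _ h h') orbT //.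
  + by case: ltgtP => //= _; apply: tot.
- by move=> u; rewrite /refine_order le0 andbT orbC -le_eqVlt.
- move=> u v w; rewrite /refine_order keyD => /orP[-> //|/andP[/eqP /(keyE w) -> h]].
  by rewrite eqxx lea ?orbT.
Qed.

End RefineOrder.

Lemma mnmc_term_order N : term_order (fun u v : 'X_{1..N} => (u <= v)%O).
Proof.
split=> [|u|u v w]; last by rewrite lemc_add2l.
  by split; [exact: lexx|exact: le_anti|move=> ? ? ?; exact: le_trans|exact: le_total].
exact: le0x.
Qed.

Section SubductionInDegreeTwo.
Variables (K : fieldType) (N n k C : nat).
Variables (P : 'I_N -> {mpoly K[n]}) (b : 'I_N -> 'X_{1..k}) (cl : 'I_N -> 'X_{1..C}).

(** The presentation with the variables [T_j] set to 1. Within one [T]-degree nothing is lost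
    ([graded_map_homog]), so leading monomials can be taken in [{mpoly K[n]}]. *)
Definition initial_map : {mpoly K[N]} -> {mpoly K[n]} := mmap (@mpolyC n K) P.
Definition graded_map : {mpoly K[N]} -> {mpoly {mpoly K[n]}[k]} :=
  mmap (@mpolyC k _ \o @mpolyC n K) (fun v => (P v)%:MP * 'X_[b v]).

HB.instance Definition _ := GRing.RMorphism.copy initial_map (mmap (@mpolyC n K) P).
HB.instance Definition _ := GRing.RMorphism.copy graded_map
  (mmap (@mpolyC k _ \o @mpolyC n K) (fun v => (P v)%:MP * 'X_[b v])).

Definition mnm_weight m (w : 'I_N -> 'X_{1..m}) (u : 'X_{1..N}) : 'X_{1..m} :=
  (\sum_i w i *+ u i)%MM.

Lemma mnm_weightD m (w : 'I_N -> 'X_{1..m}) u v :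
  mnm_weight w (u + v)%MM = (mnm_weight w u + mnm_weight w v)%MM.
Proof.
apply/mnmP => j; rewrite mnmDE !mnm_sumE -big_split /=; apply: eq_bigr => i _.
by rewrite !mulmnE mnmDE mulnDr.
Qed.

Lemma mnm_weightU m (w : 'I_N -> 'X_{1..m}) i : mnm_weight w U_(i)%MM = w i.
Proof.
apply/mnmP => j; rewrite !mnm_sumE (bigD1 i) //= mulmnE mnm1E eqxx muln1.
rewrite big1 ?addn0 // => l hl; rewrite mulmnE mnm1E.
by rewrite eq_sym (negbTE hl) muln0.
Qed.

Local Notation F u := (initial_map 'X_[u]).
Local Notation beta := (mnm_weight b).
Local Notation clw := (mnm_weight cl).
Local Notation mu u := (mlead (initial_map 'X_[u])).

Lemma graded_mapX u : graded_map 'X_[u] = (F u)%:MP * 'X_[beta u].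
Proof.
rewrite /graded_map /initial_map !mmapX /mmap1 rmorph_prod /= -mprodXE -big_split.
apply: eq_bigr => i _ /=; rewrite exprMn rmorphXn /= mpolyXn //.
Qed.

Lemma graded_mapE p : graded_map p = \sum_(u <- msupp p) (p@_u *: F u)%:MP * 'X_[beta u].
Proof.
rewrite [in LHS](mpolyE p) raddf_sum /=; apply: eq_bigr => u _.
rewrite -mul_mpolyC rmorphM /= graded_mapX mulrA; congr (_ * _).
by rewrite /graded_map mmapC /= -mul_mpolyC rmorphM.
Qed.

Lemma initial_mapE p : initial_map p = \sum_(u <- msupp p) p@_u *: F u.
Proof.
rewrite [in LHS](mpolyE p) raddf_sum /=; apply: eq_bigr => u _.
by rewrite -!mul_mpolyC rmorphM /= /initial_map mmapC.
Qed.

Lemma initial_mapZ c p : initial_map (c *: p) = c *: initial_map p.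
Proof. by rewrite -!mul_mpolyC rmorphM /= /initial_map mmapC. Qed.

Lemma graded_mapZ c p : graded_map (c *: p) = (c%:MP)%:MP * graded_map p.
Proof. by rewrite -!mul_mpolyC rmorphM /= /graded_map mmapC. Qed.

Lemma graded_map_homog p al : (forall u, u \in msupp p -> beta u = al) ->
  graded_map p = (initial_map p)%:MP * 'X_[al].
Proof.
move=> h; rewrite graded_mapE initial_mapE rmorph_sum mulr_suml /=.
by rewrite !big_seq; apply: eq_bigr => u /h ->.
Qed.

Lemma mcoeff_graded_map p al :
  (graded_map p)@_al = \sum_(u <- msupp p | beta u == al) p@_u *: F u.
Proof.
rewrite graded_mapE raddf_sum [RHS]big_mkcond /=; apply: eq_bigr => u _.
by rewrite mcoeffCM mcoeffX; case: eqP => _; rewrite (mulr1, mulr0).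
Qed.

Variable le : rel 'X_{1..N}.
Hypothesis le_to : term_order le.
Hypothesis le_mu : forall u v, le u v -> (mu u <= mu v)%O.
Hypothesis lt_mu : forall u v, (mu u < mu v)%O -> le u v.
Hypothesis F_monic : forall u, (F u)@_(mu u) = 1.
Hypothesis clw_beta : forall u v, clw u = clw v -> beta u = beta v.
Hypothesis clw_mdeg : forall u v, clw u = clw v -> mdeg u = mdeg v.

(** The Sagbi property for quadrics, class by class. Classes are finer than [T]-degrees, which keeps
    the lifted relations homogeneous in the ordinary degree as well. *)
Hypothesis sagbi2 : forall q r, mdeg q = 2 ->
  (forall s, s \in msupp r -> clw s = clw q) -> initial_map r != 0 ->
  exists s, clw s = clw q /\ mlead (initial_map r) = mu s.

(** The degree bound makes the search finite, hence the predicate boolean; [improvableP] removes it,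
    since equal classes give equal degrees. *)
Definition improvable (q : 'X_{1..N}) : bool :=
  [exists q' : 'X_{1..N < (mdeg q).+1},
     [&& clw q' == clw q, mu q' == mu q, (q' : 'X_{1..N}) != q & le q' q]].

Lemma improvableP q : reflect
  (exists q', [/\ clw q' = clw q, mu q' = mu q, q' != q & le q' q]) (improvable q).
Proof.
apply: (iffP existsP) => [[q' /and4P[/eqP ? /eqP ? ? ?]]|[q' [h ? ? ?]]].
  by exists q'.
have hd : (mdeg q' < (mdeg q).+1)%N by rewrite (clw_mdeg h).
by exists (BMultinom hd); apply/and4P; split=> //; apply/eqP.
Qed.

Definition standard (u : 'X_{1..N}) :=
  forall q, (q <= u)%MM -> mdeg q = 2 -> ~~ improvable q.

Hypothesis standard_inj : forall u v, standard u -> standard v ->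
  beta u = beta v -> mu u = mu v -> u = v.

(** Sagbi division: [sagbi2] yields a monomial of the same class whose image cancels the leading
    term. The induction is on the leading monomial of the image, which starts below [mu q] and
    drops. *)
Lemma subduction q r : mdeg q = 2 ->
  (forall s, s \in msupp r -> clw s = clw q) ->
  (initial_map r = 0 \/ (mlead (initial_map r) < mu q)%O) ->
  exists r', [/\ forall s, s \in msupp r' -> clw s = clw q,
    forall s, s \in msupp r' -> (mu s < mu q)%O & initial_map r' = initial_map r].
Proof.
move=> hq; move em : (mlead (initial_map r)) => m.
elim/(@ltmwf n): m r em => m IH r em hr hlt.
have [r0|r0] := eqVneq (initial_map r) 0.
  exists 0; rewrite raddf0 r0; split=> // s; by rewrite msupp0.
have {hlt} hlt : (m < mu q)%O by case: hlt => // e; rewrite e eqxx in r0.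
have [s [hs1 hs2]] := sagbi2 hq hr r0.
set a := (initial_map r)@_m.
pose r1 := r - a *: 'X_[s].
have r1E : initial_map r1 = initial_map r - a *: F s.
  by rewrite /r1 raddfB /= initial_mapZ.
have r1s : forall s, s \in msupp r1 -> clw s = clw q.
  move=> s' /msuppB_le; rewrite mem_cat => /orP[/hr //|/msuppZ_le].
  by rewrite msuppX inE => /eqP ->.
have coef0 : (initial_map r1)@_m = 0.
  have fs1 : (F s)@_m = 1 by rewrite -em hs2 F_monic.
  by rewrite r1E mcoeffB mcoeffZ fs1 mulr1 subrr.
have lead_le : (mlead (initial_map r1) <= m)%O.
  rewrite r1E; apply: le_trans (mleadB_le _ _) _; rewrite em.
  by rewrite leUx lexx /=; apply: le_trans (mleadZ_le _ _) _; rewrite -hs2 em.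
have hr1 : initial_map r1 = 0 \/ (mlead (initial_map r1) < m)%O.
  have [->|nz] := eqVneq (initial_map r1) 0; first by left.
  right; rewrite lt_neqAle lead_le andbT; apply/eqP => e.
  by move: nz; rewrite -mleadc_eq0 e coef0 eqxx.
have [r' [h1 h2 h3]] : exists r', [/\ forall s, s \in msupp r' -> clw s = clw q,
    forall s, s \in msupp r' -> (mu s < mu q)%O & initial_map r' = initial_map r1].
  case: hr1 => [e|h].
    by exists 0; rewrite raddf0 e; split=> // s'; rewrite msupp0.
  by apply: (IH _ h r1 erefl r1s); right; apply: lt_trans hlt.
exists (r' + a *: 'X_[s]).
have sp s' : s' \in msupp (r' + a *: 'X_[s]) -> s' \in msupp r' \/ s' = s.
  move=> /msuppD_le; rewrite mem_cat => /orP[|/msuppZ_le]; first by left.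
  by rewrite msuppX inE => /eqP; right.
split=> [s' /sp[/h1 //|-> //]|s' /sp[/h2 //|->]|]; first by rewrite -hs2 em.
by rewrite raddfD /= initial_mapZ h3 r1E subrK.
Qed.

(** In the image of the binomial [q - q'] the common initial monomial cancels, and subduction
    rewrites what remains by monomials with smaller [mu]. The order compares [mu] first, so
    subtracting these leaves [q] in the lead. *)
Lemma quadric_of_improvable q : mdeg q = 2 -> improvable q ->
  exists g, [/\ graded_map g = 0, is_lead le g q & g \is 2.-homog].
Proof.
move=> hq /improvableP[q' [cq mq nq lq]].
have [[le_refl le_anti le_trans le_total] _ _] := le_to.
pose r := 'X_[q] - 'X_[q'] : {mpoly K[N]}.
have rs s : s \in msupp r -> clw s = clw q.
  by move/msuppB_le; rewrite mem_cat !msuppX !inE => /orP[] /eqP ->.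
have coef0 : (initial_map r)@_(mu q) = 0.
  by rewrite raddfB /= mcoeffB F_monic -mq F_monic subrr.
have lead_le : (mlead (initial_map r) <= mu q)%O.
  rewrite raddfB /=; apply: Order.POrderTheory.le_trans (mleadB_le _ _) _.
  by rewrite mq leUx lexx.
have [r' [h1 h2 h3]] : exists r', [/\ forall s, s \in msupp r' -> clw s = clw q,
    forall s, s \in msupp r' -> (mu s < mu q)%O & initial_map r' = initial_map r].
  apply: (subduction hq rs).
  have [->|nz] := eqVneq (initial_map r) 0; first by left.
  right; rewrite lt_neqAle lead_le andbT; apply/eqP => e.
  by move: nz; rewrite -mleadc_eq0 e coef0 eqxx.
have gs s : s \in msupp (r - r') -> [\/ s = q, s = q' | s \in msupp r'].
  move/msuppB_le; rewrite mem_cat => /orP[/msuppB_le|]; last by constructor 3.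
  by rewrite mem_cat !msuppX !inE => /orP[] /eqP ->; [constructor 1|constructor 2].
have gc s : s \in msupp (r - r') -> clw s = clw q.
  by move=> /gs[->|->|/h1].
exists (r - r'); split.
- rewrite (@graded_map_homog _ (beta q)).
    by rewrite raddfB /= h3 subrr mpolyC0 mul0r.
  by move=> u /gc /clw_beta.
- split.
    rewrite mcoeff_msupp !mcoeffB !mcoeffX eqxx (negbTE nq) subr0.
    rewrite (memN_msupp_eq0 (p := r')) ?subr0 ?oner_eq0 //.
    by apply/negP => /h2; rewrite ltxx.
  move=> s /gs[->|->|/h2 /lt_mu] //.
- by apply/dhomogP => s /gc /clw_mdeg e; exact: etrans e hq.
Qed.

Lemma mem_ltn_card (T : finType) (A B : pred T) x :
  {subset A <= B} -> x \in B -> x \notin A -> (#|A| < #|B|)%N.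
Proof.
move=> sAB xB xA; apply: proper_card; apply/properP; split; first exact/subsetP.
by exists x.
Qed.

Lemma is_lead_shift (g : {mpoly K[N]}) q w : is_lead le g q ->
  is_lead le (g * 'X_[w]) (q + w)%MM.
Proof.
have [[_ _ _ _] _ lea] := le_to.
case=> h1 h2; split; first by rewrite mcoeff_msupp addmC mcoeffMX -mcoeff_msupp.
move=> v; rewrite (perm_mem (msuppMX g w)) => /mapP[v' hv' ->].
by rewrite addmC; apply/lea/h2.
Qed.

Lemma standardVn w :
  standard w \/ exists q, [/\ (q <= w)%MM, mdeg q = 2 & improvable q].
Proof.
have [/existsP[q /and3P[h1 /eqP h2 h3]]|/existsPn h] := boolP
  [exists q : 'X_{1..N < 3}, [&& (q <= w)%MM, mdeg q == 2 & improvable q]].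
  by right; exists q.
left=> q h1 h2; have hq : (mdeg q < 3)%N by rewrite h2.
by have := h (BMultinom hq); rewrite /= h1 h2 eqxx.
Qed.

Lemma replace_monomials (Q : 'X_{1..N} -> 'X_{1..N} -> Prop) p :
  (forall s, s \in msupp p -> exists r, graded_map ('X_[s] - r) = 0 /\
    (forall s', s' \in msupp r -> Q s s')) ->
  exists r, graded_map (p - r) = 0 /\
    (forall s', s' \in msupp r -> exists2 s, s \in msupp p & Q s s').
Proof.
move=> step.
suff key (l : seq 'X_{1..N}) : {subset l <= msupp p} -> exists r,
    graded_map (\sum_(s <- l) p@_s *: 'X_[s] - r) = 0 /\
    (forall s', s' \in msupp r -> exists2 s, s \in msupp p & Q s s').
  by have := key (msupp p) (fun x => id); rewrite -mpolyE.
elim: l => [|s l IHl] hl'.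
  by exists 0; rewrite big_nil subr0 raddf0; split=> // s; rewrite msupp0.
have [|r1 [h1 h2]] := IHl; first by move=> x hx; apply: hl'; rewrite inE hx orbT.
have sp : s \in msupp p by apply: hl'; rewrite inE eqxx.
have [r2 [h3 h4]] := step s sp; exists (p@_s *: r2 + r1); split.
  rewrite big_cons opprD addrACA raddfD /= h1 addr0 -scalerBr graded_mapZ h3.
  by rewrite mulr0.
move=> s' /msuppD_le; rewrite mem_cat => /orP[/msuppZ_le/h4 hs'|/h2 //].
by exists s.
Qed.

(** The quadrics are homogeneous, so rewriting keeps the degree [D]. The measure is the number of
    monomials of degree at most [D] below [w], which is finite. *)
Lemma standard_span w : exists r, graded_map ('X_[w] - r) = 0 /\
  (forall s, s \in msupp r -> standard s /\ le s w).
Proof.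
have [[le_refl le_anti le_trans le_total] _ lea] := le_to.
have [D DE] : exists D, mdeg w = D by eexists.
have [m] := ubnP #|[pred s : 'X_{1..N < D.+1} | le s w]|.
elim: m w DE => // m IH w DE; rewrite ltnS => hm.
case: (standardVn w) => [hw|[q [qw dq iq]]].
  exists 'X_[w]; rewrite subrr raddf0; split=> // s.
  by rewrite msuppX inE => /eqP ->.
have [g [g0 gl gh]] := quadric_of_improvable dq iq.
have [gq gle] := gl.
have [hl hle] := is_lead_shift (w - q)%MM gl.
pose h := (g@_q)^-1 *: (g * 'X_[w - q]).
have ewq : (q + (w - q) = w)%MM by rewrite addmC submK.
rewrite ewq in hl hle.
have h0 : graded_map h = 0 by rewrite graded_mapZ rmorphM /= g0 mul0r mulr0.
pose p := 'X_[w] - h.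
have hw : h@_w = 1.
  have gw : (g * 'X_[w - q])@_w = g@_q by rewrite -(mcoeffMX g (w - q)%MM q) submK.
  by rewrite mcoeffZ gw mulVf // -mcoeff_msupp.
have hs s : s \in msupp h -> le s w /\ mdeg s = D.
  move/msuppZ_le => hs; split; first exact: hle.
  have : g * 'X_[w - q] \is (2 + mdeg (w - q)%MM).-homog.
    by rewrite dhomogM // dhomogX.
  move/dhomogP/(_ _ hs) => ->; rewrite -DE -[in RHS]ewq mdegD dq //.
have ps s : s \in msupp p -> [/\ le s w, s != w & mdeg s = D].
  move=> sp; have sw : s != w.
    apply: contraTneq sp => ->; rewrite mcoeff_msupp negbK /p mcoeffB hw mcoeffX.
    by rewrite eqxx subrr.
  move: sp => /msuppB_le; rewrite mem_cat msuppX inE (negbTE sw) /= => /hs[].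
  by split.
have step s : s \in msupp p -> exists r, graded_map ('X_[s] - r) = 0 /\
    (forall s', s' \in msupp r -> standard s' /\ le s' s).
  move=> /ps[h1 h2 h3]; apply: IH => //; apply: leq_trans hm.
  have hwD : (mdeg w < D.+1)%N by rewrite DE.
  apply: (@mem_ltn_card _ _ _ (BMultinom hwD)).
  - by move=> x; rewrite !inE => hx; apply: le_trans h1.
  - by rewrite inE /= le_refl.
  - rewrite inE /=; apply/negP => h4; move/eqP: h2; apply.
    by apply: le_anti; rewrite h1.
have [r [r0 rs]] := replace_monomials step.
exists r; split; last first.
  by move=> s' /rs[s /ps[sw _ _] [hs' ss']]; split=> //; apply: le_trans sw.
have -> : 'X_[w] - r = (p - r) + h by rewrite /p addrAC subrK.
by rewrite raddfD /= r0 h0 addr0.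
Qed.

Lemma standard_span_poly p : exists r, graded_map (p - r) = 0 /\
  (forall s', s' \in msupp r -> exists2 s, s \in msupp p & standard s' /\ le s' s).
Proof. by apply: replace_monomials => s _; apply: standard_span. Qed.

(** Were [u] standard, replacing the other terms of [f] by standard ones would give a kernel element
    led by [u]. Its coefficient at [mu u] in [T]-degree [beta u] comes from [u] alone: by
    [standard_inj] every other standard term of that [T]-degree has strictly smaller [mu]. *)
Lemma lead_not_standard f u : graded_map f = 0 -> is_lead le f u -> ~ standard u.
Proof.
have [[le_refl le_anti le_trans le_total] _ lea] := le_to.
move=> f0 [uf ul] su.
set a := f@_u; have a0 : a != 0 by rewrite -mcoeff_msupp.
pose f' := f - a *: 'X_[u].
have f's w : w \in msupp f' -> le w u /\ w != u.
  move=> wf; have wu : w != u.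
    apply: contraTneq wf => ->.
    by rewrite mcoeff_msupp negbK mcoeffB mcoeffZ mcoeffX eqxx mulr1 subrr.
  split=> //; apply: ul; move: wf => /msuppB_le; rewrite mem_cat => /orP[//|].
  by move/msuppZ_le; rewrite msuppX inE (negbTE wu).
have [r [r0 rs]] := standard_span_poly f'.
have ru s : s \in msupp r -> [/\ standard s, le s u & s != u].
  move=> /rs[w /f's[wu nwu] [ss sw]]; split=> //; first exact: le_trans wu.
  by apply: contraNneq nwu => e; apply/eqP/le_anti; rewrite wu -e.
have e0 : graded_map (a *: 'X_[u] + r) = 0.
  have -> : a *: 'X_[u] + r = f - (f' - r).
    by rewrite /f' opprB addrCA opprB [f + _]addrC subrK addrC.
  by rewrite raddfB /= f0 r0 subr0.
have := congr1 (mcoeff (mu u) \o mcoeff (beta u)) e0.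
rewrite /= raddfD /= graded_mapZ graded_mapX mcoeffD !mcoeffCM mcoeffX eqxx mulr1.
rewrite mcoeffD mcoeffCM F_monic mulr1 mcoeff_graded_map raddf_sum /= big_seq_cond big1.
  by move=> e; move/eqP: e; rewrite addr0 !mcoeff0 (negbTE a0).
move=> s /andP[/ru[ss su' nsu] /eqP hb].
have lt_su : (mu s < mu u)%O.
  rewrite lt_neqAle (le_mu su') andbT.
  by apply: contraNneq nsu => e; apply/eqP/standard_inj.
by rewrite mcoeffZ (mcoeff_gt_mlead lt_su) mulr0.
Qed.

Theorem quadratic_groebner_basis : exists G : seq {mpoly K[N]},
  groebner_basis le (fun p => graded_map p = 0) G /\
  (forall g, g \in G -> g \is 2.-homog).
Proof.
pose Q := [seq bmnm q | q : 'X_{1..N < 3} <- enum {: 'X_{1..N < 3}}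
   & (mdeg q == 2) && improvable q].
have QP q : q \in Q -> mdeg q = 2 /\ improvable q.
  by case/mapP => q'; rewrite mem_filter => /andP[/andP[/eqP ? ?] _] ->.
have [G [G1 G2]] : exists G : seq {mpoly K[N]},
    (forall g, g \in G -> [/\ g != 0, graded_map g = 0 & g \is 2.-homog]) /\
    (forall q, q \in Q -> exists2 g, g \in G & is_lead le g q).
  elim: Q QP => [|q Q IH] QP; first by exists [::].
  have [x hx|G [G1 G2]] := IH; first by apply: QP; rewrite inE hx orbT.
  have [|d2 iq] := QP q; first by rewrite inE eqxx.
  have [g [g0 gl gh]] := quadric_of_improvable d2 iq.
  exists (g :: G); split=> [g'|q'].
    rewrite inE => /orP[/eqP -> |/G1 //]; split=> //.
    by apply: contraTneq gl.1 => ->; rewrite msupp0.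
  rewrite inE => /orP[/eqP ->|/G2[g' h1 h2]]; first by exists g; rewrite ?inE ?eqxx.
  by exists g'; rewrite // inE h1 orbT.
exists G; split; last by move=> g /G1[].
split; [by move=> g /G1[]|by move=> g /G1[]|move=> p; split=> -[s [h1 h2]]].
  have gen u : u \in s -> exists w, initial_ideal le (fun g => g \in G) w /\ w = u.1 * u.2.
    move=> /h1[f [m [f0 ml e]]]; exists (u.1 * u.2); split=> //.
    have [q [qm dq iq]] : exists q, [/\ (q <= m)%MM, mdeg q = 2 & improvable q].
      by case: (standardVn m) => // /(lead_not_standard f0 ml).
    have hq3 : (mdeg q < 3)%N by rewrite dq.
    have [|g gG gl] := G2 q.
      apply/mapP; exists (BMultinom hq3) => //.
      by rewrite mem_filter /= dq eqxx iq mem_enum.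
    exists [:: (u.1 * 'X_[m - q], 'X_[q])]; split.
      by move=> v; rewrite inE => /eqP -> /=; exists g, q.
    by rewrite big_seq1 /= -mulrA -mpolyXD submK // e.
  rewrite h2 {h2}; elim: s h1 gen => [|u s IH] h1 gen.
    by exists [::]; rewrite big_nil.
  have sub v : v \in s -> v \in u :: s by rewrite inE => ->; rewrite orbT.
  have [s1 [hs1 es1]] := IH (fun v hv => h1 v (sub v hv)) (fun v hv => gen v (sub v hv)).
  have [|w [[s2 [hs2 es2]] ew]] := gen u; first by rewrite inE eqxx.
  exists (s2 ++ s1); split.
    by move=> v; rewrite mem_cat => /orP[/hs2|/hs1].
  by rewrite big_cat /= big_cons -es2 ew es1.
exists s; split=> // u /h1[g [m [/G1[_ g0 _] ml e]]].
by exists g, m.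
Qed.

End SubductionInDegreeTwo.

(** * Minors and their leading monomials *)

(** The block matrix with rows [(1, - b)] and [(a, M)] has determinant [\det (M + a *m b)] by
    elimination of [a]. Multiplying it by a triangular matrix built from [\adj M] gives the other
    side, up to a factor [\det M] that regularity cancels. *)
Lemma det_add_rank1_reg (R : comNzRingType) t (M : 'M[R]_t) (a : 'cV_t) (b : 'rV_t) :
  GRing.rreg (\det M) ->
  \det (M + a *m b) = \det M + (b *m \adj M *m a) 0 0.
Proof.
apply.
pose B := block_mx 1%:M (- b) a M.
have e1 : B = block_mx 1%:M 0 a 1%:M *m block_mx 1%:M (- b) 0 (M + a *m b).
  rewrite mulmx_block !mulmx1 !mul1mx !mul0mx ?mulmx0 !addr0 mulmxN.
  by rewrite addrC addrK.
have e2 : B *m block_mx (\det M)%:M 0 (- (\adj M *m a)) 1%:M =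
    block_mx ((\det M)%:M + b *m \adj M *m a) (- b) 0 M.
  rewrite mulmx_block !mulmx1 !mul1mx !mulmx0 !add0r mulmxN mulNmx opprK mulmxN.
  rewrite !mulmxA mul_mx_adj mul_mx_scalar mul_scalar_mx subrr.
  by [].
have d1 : \det B = \det (M + a *m b).
  by rewrite e1 det_mulmx det_lblock det_ublock !det1 !mul1r.
have := congr1 determinant e2.
rewrite det_mulmx d1 det_lblock det_ublock det1 mulr1 det_scalar1 => ->.
by rewrite det_mx11 !mxE eqxx mulr1n.
Qed.

(* The determinant becomes regular over [R[X]] once [X] is added on the
   diagonal; then set [X = 0]. *)
Lemma det_add_rank1 (R : comNzRingType) t (M : 'M[R]_t) (a : 'cV_t) (b : 'rV_t) :
  \det (M + a *m b) = \det M + (b *m \adj M *m a) 0 0.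
Proof.
pose M' := char_poly_mx (- M).
have := det_add_rank1_reg (map_mx polyC a) (map_mx polyC b)
  (monic_rreg (char_poly_monic (- M))).
have ev0 : map_mx (horner_eval 0) M' = M.
  apply/matrixP => i j; rewrite !mxE /horner_eval hornerD hornerN hornerMn.
  by rewrite hornerX mul0rn hornerC sub0r opprK.
have evC m p (A : 'M[R]_(m, p)) : map_mx (horner_eval 0) (map_mx polyC A) = A.
  by apply/matrixP => i j; rewrite !mxE /horner_eval hornerC.
move/(congr1 (horner_eval 0)); rewrite /char_poly -/M' rmorphD /= -!det_map_mx.
rewrite map_mxD map_mxM !evC ev0 => ->; congr (_ + _).
have -> : b *m \adj M *m a =
    map_mx (horner_eval 0) (map_mx polyC b *m \adj M' *m map_mx polyC a).
  by rewrite !map_mxM map_mx_adj !evC ev0.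
by rewrite [RHS]mxE.
Qed.

Lemma det_map_add_rank1 (R S : comNzRingType)
    (h : {rmorphism R -> S}) t (M : 'M[R]_t) (a : 'cV_t) (b : 'rV_t) :
  \det (map_mx h M + a *m b) =
    h (\det M) + \sum_j (\sum_i b 0 i * h (cofactor M j i)) * a j 0.
Proof.
rewrite -det_map_mx det_add_rank1 mxE; congr (_ + _).
apply: eq_bigr => j _; rewrite mxE; congr (_ * _); apply: eq_bigr => i _.
by rewrite mxE cofactor_map_mx.
Qed.

Lemma mlead_eq (n : nat) (R : nzRingType) (p : {mpoly R[n]}) m :
  p@_m != 0 -> (forall m', m' \in msupp p -> (m' <= m)%O) -> mlead p = m.
Proof.
move=> pm h; apply/le_anti; rewrite msupp_le_mlead ?mcoeff_msupp // andbT.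
by apply: h; apply: mlead_supp; apply: contraNneq pm => ->; rewrite mcoeff0.
Qed.

Lemma mcoeffMXE (n : nat) (R : comNzRingType) (p : {mpoly R[n]}) a m :
  (p * 'X_[a])@_m = if (a <= m)%MM then p@_(m - a)%MM else 0.
Proof.
case: ifP => [h|/negP h]; first by rewrite -{1}(submK h) addmC mcoeffMX.
apply: memN_msupp_eq0; rewrite (perm_mem (msuppMX p a)); apply/mapP => -[m' _ e].
by apply: h; rewrite e lem_addr.
Qed.

Section Minors.
Variables (K : fieldType) (n c : nat).
Hypothesis c_gt0 : (0 < c)%N.

(** Natural numbers as indices avoid range proofs inside matrices. Out of range [nX] is the monomial
    1 while [nvar] is 0, so the two correspond only below [n]. *)
Definition nX (x : nat) : 'X_{1..n} := if insub x is Some i then U_(i)%MM else 0%MM.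
Definition nvar (x : nat) : {mpoly K[n]} := if insub x is Some i then 'X_i else 0.
Definition ev (m : 'X_{1..n}) (x : nat) : nat := if insub x is Some i then m i else 0.

Lemma nX_ord (i : 'I_n) : nX i = U_(i)%MM.
Proof. by rewrite /nX valK. Qed.

Lemma nvar_ord (i : 'I_n) : nvar i = 'X_i.
Proof. by rewrite /nvar valK. Qed.

Lemma ev_ord m (i : 'I_n) : ev m i = m i.
Proof. by rewrite /ev valK. Qed.

Lemma ev_out m x : (n <= x)%N -> ev m x = 0%N.
Proof. by move=> h; rewrite /ev insubN // -leqNgt. Qed.

Lemma evD m1 m2 x : ev (m1 + m2)%MM x = (ev m1 x + ev m2 x)%N.
Proof. by rewrite /ev; case: insub => // i; rewrite mnmDE. Qed.

Lemma ev0 x : ev 0%MM x = 0%N.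
Proof. by rewrite /ev; case: insub => // i; rewrite mnm0E. Qed.

Lemma ev_nX x y : (x < n)%N -> ev (nX x) y = (x == y).
Proof.
move=> hx; rewrite -[x]/(nat_of_ord (Ordinal hx)) nX_ord.
have [hy|hy] := ltnP y n.
  by rewrite -[y]/(nat_of_ord (Ordinal hy)) ev_ord mnm1E.
rewrite ev_out //; apply/esym/eqP; rewrite eqb0 /=; apply/eqP => e.
by move: hx; rewrite e ltnNge hy.
Qed.

Lemma ev_sum (I : Type) (r : seq I) (Q : pred I) (F : I -> 'X_{1..n}) x :
  ev (\sum_(i <- r | Q i) F i)%MM x = (\sum_(i <- r | Q i) ev (F i) x)%N.
Proof.
by elim/big_rec2: _ => [|i a b _ <-]; rewrite ?ev0 ?evD.
Qed.

Lemma nvarE x : (x < n)%N -> nvar x = 'X_[nX x].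
Proof. by move=> hx; rewrite -[x]/(nat_of_ord (Ordinal hx)) nX_ord nvar_ord. Qed.

Definition strict t (f : 'I_t -> nat) := {homo f : i j / (i < j)%N}.
Definition in_range t (f g : 'I_t -> nat) := forall i j, (f i * c + g j < n)%N.

Definition gminor t (f g : 'I_t -> nat) : {mpoly K[n]} :=
  \det (\matrix_(i, j) nvar (f i * c + g j)).

Definition diag_mnm t (f g : 'I_t -> nat) (s : 'S_t) : 'X_{1..n} :=
  (\sum_i nX (f i * c + g (s i)))%MM.

Lemma ltmc_ev (m1 m2 : 'X_{1..n}) y : mdeg m1 = mdeg m2 ->
  (forall z, (z < y)%N -> ev m1 z = ev m2 z) -> (ev m1 y < ev m2 y)%N -> (m1 < m2)%O.
Proof.
move=> e h1 h2; apply/ltmcP => //.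
have hy : (y < n)%N by rewrite ltnNge; apply: contraL h2 => h; rewrite !ev_out.
exists (Ordinal hy); last by rewrite -!ev_ord.
by move=> j hj; rewrite -!ev_ord h1.
Qed.

Lemma strict_le t (f : 'I_t -> nat) : strict f -> {homo f : i j / (i <= j)%N}.
Proof.
move=> h i j; rewrite leq_eqVlt => /orP[/eqP/val_inj -> //|/h]; exact: ltnW.
Qed.

Lemma diag_mnm_lt t (f g : 'I_t -> nat) (s : 'S_t) : strict f -> strict g ->
  in_range f g -> s != 1%g -> (diag_mnm f g s < diag_mnm f g 1%g)%O.
Proof.
move=> hf hg hr s1.
have hf' := strict_le hf; have hg' := strict_le hg.
have [i0 hi0 mini] : exists2 i0, s i0 != i0 & forall i : 'I_t, (i < i0)%N -> s i = i.
  have [j hj] : exists j, s j != j.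
    apply/existsP; apply: contraR s1 => /existsPn h; apply/eqP/permP => i.
    by rewrite perm1; apply/eqP; have := h i; rewrite negbK.
  case: (arg_minnP (P := fun j => s j != j) val hj) => i0 h0 h1; exists i0 => // i.
  by apply: contraTeq => /h1; rewrite -leqNgt.
have sge (i : 'I_t) : (i0 <= i)%N -> (i0 <= s i)%N.
  move=> hi; rewrite leqNgt; apply/negP => h; have := mini _ h.
  by move/perm_inj => e; move: h; rewrite e ltnNge hi.
have sgt : (i0 < s i0)%N.
  rewrite ltn_neqAle sge // andbT eq_sym; exact: hi0.
have deg s' : mdeg (diag_mnm f g s') = t.
  rewrite /diag_mnm mdeg_sum (eq_bigr (fun=> 1%N)) ?sum1_card ?card_ord //.
  by move=> i _; rewrite -[(_ + _)%N]/(nat_of_ord (Ordinal (hr i (s' i)))) nX_ord mdeg1.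
have evE s' z : ev (diag_mnm f g s') z = (\sum_i (f i * c + g (s' i) == z))%N.
  by rewrite ev_sum; apply: eq_bigr => i _; rewrite ev_nX.
(* The exponents are compared at the diagonal entry of the first row moved by [s]. Smaller indices
   occur only in earlier rows, where both terms agree; later rows have strictly larger indices
   because [c] is positive. *)
apply: (@ltmc_ev _ _ (f i0 * c + g i0)); first by rewrite !deg.
  move=> z hz; rewrite !evE; apply: eq_bigr => i _; rewrite perm1.
  have [/mini -> //|hi] := ltnP i i0.
  have := hf' _ _ hi; have := hg' _ _ hi; have := hg' _ _ (sge _ hi).
  have := leq_mul2r c (f i0) (f i).
  by case: eqP; case: eqP => //; lia.
rewrite !evE (bigD1 i0) //= [ltnRHS](bigD1 i0) //= perm1 eqxx.
have := hg _ _ sgt => h1; rewrite (_ : (_ == _) = false) ?add0n ?add1n ?ltnS; last lia.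
apply: leq_sum => i hi; rewrite perm1.
have [/mini -> //|hi'] := ltnP i i0.
have {hi'}h2 : (i0 < i)%N by rewrite ltn_neqAle hi' andbT eq_sym; exact: hi.
have := hf _ _ h2; have := hg' _ _ (sge i (ltnW h2)).
have := ltn_mul2r c (f i0) (f i); rewrite c_gt0 /=.
by case: eqP => //; lia.
Qed.

Lemma gminorE t (f g : 'I_t -> nat) : in_range f g ->
  gminor f g = \sum_(s : 'S_t) (-1) ^+ s *: 'X_[diag_mnm f g s].
Proof.
move=> hr; rewrite /gminor /determinant; apply: eq_bigr => s _.
rewrite -mul_mpolyC rmorphXn rmorphN rmorph1; congr (_ * _).
rewrite /diag_mnm -mprodXE; apply: eq_bigr => i _.
by rewrite mxE nvarE.
Qed.

Lemma gminor_lead t (f g : 'I_t -> nat) : strict f -> strict g -> in_range f g ->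
  mlead (gminor f g) = diag_mnm f g 1%g /\ (gminor f g)@_(diag_mnm f g 1%g) = 1.
Proof.
move=> hf hg hr.
have coef1 : (gminor f g)@_(diag_mnm f g 1%g) = 1.
  rewrite gminorE // raddf_sum /= (bigD1 (1%g : 'S_t)) //=.
  rewrite mcoeffZ mcoeffX eqxx odd_perm1 mulr1.
  rewrite expr0 big1 ?addr0 // => s s1; rewrite mcoeffZ mcoeffX.
  by rewrite (lt_eqF (diag_mnm_lt hf hg hr s1)) mulr0.
split=> //; apply: mlead_eq; first by rewrite coef1 oner_eq0.
move=> m; rewrite gminorE // => /msupp_sum_le /flattenP[l /mapP[s _ ->]].
move/msuppZ_le; rewrite msuppX inE => /eqP ->.
by have [-> //|/(diag_mnm_lt hf hg hr)/ltW] := eqVneq s 1%g.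
Qed.

(** The rows are not tied to one [X_t]: the cofactors of a minor are then, up to sign, again minors
    of this kind, and the variables are the minors of size one. *)
Definition minors t (p : {mpoly K[n]}) : Prop :=
  exists f g : 'I_t -> nat, [/\ strict f, strict g, in_range f g & p = gminor f g].

Definition Jideal t := ideal_gen (minors t).

End Minors.

(** * Rank-one shifts *)

Section IsIdeal.
Variable R : comNzRingType.

Definition is_ideal (I : R -> Prop) :=
  [/\ I 0, forall a b, I a -> I b -> I (a + b) & forall r a, I a -> I (r * a)].

Lemma ideal_gen_ideal S : is_ideal (ideal_gen (R := R) S).
Proof.
split.
- by exists [::]; rewrite big_nil.
- move=> a b [s [hs ->]] [s' [hs' ->]]; exists (s ++ s'); split.
    by move=> u; rewrite mem_cat => /orP[/hs|/hs'].
  by rewrite big_cat.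
- move=> r a [s [hs ->]]; exists [seq (r * u.1, u.2) | u <- s]; split.
    by move=> u /mapP[v hv ->] /=; apply: hs.
  by rewrite big_map mulr_sumr; apply: eq_bigr => u _; rewrite mulrA.
Qed.

Lemma ideal_gen_incl (S : R -> Prop) p : S p -> ideal_gen S p.
Proof.
move=> h; exists [:: (1, p)]; rewrite big_seq1 mul1r; split=> // u.
by rewrite inE => /eqP ->.
Qed.

Lemma ideal_sum (I : R -> Prop) (T : eqType) (r : seq T) (F : T -> R) :
  is_ideal I -> (forall i, i \in r -> I (F i)) -> I (\sum_(i <- r) F i).
Proof.
case=> I0 ID _; elim: r => [|i r IH] h; first by rewrite big_nil.
rewrite big_cons; apply: ID; first by apply: h; rewrite inE eqxx.
by apply: IH => j hj; apply: h; rewrite inE hj orbT.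
Qed.

Lemma ideal_gen_sub (S I : R -> Prop) : is_ideal I -> (forall p, S p -> I p) ->
  forall p, ideal_gen S p -> I p.
Proof.
move=> hI hS p [s [hs ->]]; apply: ideal_sum => // u /hs /hS; by case: hI => _ _; apply.
Qed.

End IsIdeal.

Section Substitution.
Variables (K : fieldType) (n c : nat).
Hypothesis c_gt0 : (0 < c)%N.

(* The variable [x_i] is shifted by [y_i = u_(i mod c) s^(i div c)]: the matrix
   [X_t] evaluated at [y] has rank one. *)
Definition wt (x : nat) : 'X_{1..c.+1} :=
  (U_(ord0) *+ (x %/ c) + U_(inord (x %% c).+1))%MM.

Definition shift : {mpoly K[n]} -> {mpoly {mpoly K[n]}[c.+1]} :=
  mmap (@mpolyC c.+1 _ \o @mpolyC n K) (fun i => ('X_i)%:MP + 'X_[wt i]).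

HB.instance Definition _ := GRing.RMorphism.copy shift
  (mmap (@mpolyC c.+1 _ \o @mpolyC n K) (fun i => ('X_i)%:MP + 'X_[wt i])).

Local Notation Wt := (mnm_weight (fun i : 'I_n => wt i)).

Lemma shiftX i : shift 'X_i = ('X_i)%:MP + 'X_[wt i].
Proof. by rewrite /shift mmapX mmap1U. Qed.

Lemma shift_nvar x : (x < n)%N -> shift (nvar K n x) = (nvar K n x)%:MP + 'X_[wt x].
Proof. by move=> hx; rewrite -[x]/(nat_of_ord (Ordinal hx)) nvar_ord shiftX. Qed.

Lemma shiftZ a p : shift (a *: p) = (a%:MP)%:MP * shift p.
Proof. by rewrite -!mul_mpolyC rmorphM /= /shift mmapC. Qed.

Lemma mcoeff_shift p m q : (shift p)@_m@_q =
  \sum_(v <- msupp p) p@_v * (shift 'X_[v])@_m@_q.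
Proof.
have -> : shift p = \sum_(v <- msupp p) shift (p@_v *: 'X_[v]).
  by rewrite {1}(mpolyE p) raddf_sum.
rewrite (raddf_sum (mcoeff m)) (raddf_sum (mcoeff q)); apply: eq_bigr => v _ /=.
by rewrite shiftZ !mcoeffCM.
Qed.

Lemma mcoeff_shiftS i v m q : (shift 'X_[U_(i) + v])@_m@_q =
  (if (U_(i) <= q)%MM then (shift 'X_[v])@_m@_(q - U_(i)) else 0) +
  (if (wt i <= m)%MM then (shift 'X_[v])@_(m - wt i)@_q else 0).
Proof.
rewrite mpolyXD rmorphM /= shiftX mulrDl mcoeffD mcoeffD; congr (_ + _).
  by rewrite mcoeffCM mulrC mcoeffMXE.
by rewrite mulrC mcoeffMXE; case: ifP => // _; rewrite mcoeff0.
Qed.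

Lemma mnm_ind (Q : 'X_{1..n} -> Prop) : Q 0%MM ->
  (forall i v, Q v -> Q (U_(i) + v)%MM) -> forall v, Q v.
Proof.
move=> Q0 QS v; have [d] := ubnP (mdeg v); elim: d v => // d IH v hv.
have [-> //|] := eqVneq v 0%MM; rewrite -mdeg_eq0 mdegE sum_nat_eq0 => /forallPn[i].
rewrite implyTb -lep1mP => h; rewrite -(submK h) addmC; apply/QS/IH.
by rewrite -(ltn_add2r (mdeg U_(i))) -mdegD submK // mdeg1 addn1.
Qed.

(** [v'] collects the factors of [v] that contribute [y_i] instead of [x_i]. *)
Lemma shift_supp v m q : (shift 'X_[v])@_m@_q != 0 ->
  exists v', v = (q + v')%MM /\ Wt v' = m.
Proof.
elim/mnm_ind: v m q => [m q|i v IH m q].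
  rewrite mpolyX0 rmorph1 mcoeff1; case: (m =P 0%MM) => [-> |_]; last first.
    by rewrite mcoeff0 eqxx.
  rewrite mcoeff1; case: (q =P 0%MM) => [-> _|_]; last by rewrite eqxx.
  exists 0%MM; rewrite addm0; split=> //; apply/mnmP => j.
  by rewrite mnm_sumE mnm0E big1 // => l _; rewrite mulmnE mnm0E muln0.
have add_neq0 (a b : K) : a + b != 0 -> a != 0 \/ b != 0.
  by have [->|] := eqVneq a 0; [rewrite add0r; right|left].
rewrite mcoeff_shiftS => /add_neq0[].
  case: ifP => [h /IH[v' [e1 e2]]|]; last by rewrite eqxx.
  by exists v'; split=> //; rewrite e1 addmA [(U_(i) + _)%MM]addmC submK.
case: ifP => [h /IH[v' [e1 e2]]|]; last by rewrite eqxx.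
exists (U_(i) + v')%MM; split; first by rewrite e1 !addmA [(q + _)%MM]addmC.
by rewrite mnm_weightD mnm_weightU e2 addmC submK.
Qed.

Lemma wt_neq0 x : (wt x == 0)%MM = false.
Proof. by rewrite /wt mnmD_eq0 mnm1_eq0 andbF. Qed.

(** Disjoint supports leave one way to choose [x_i] or [y_i] in every factor, so no binomial
    coefficient arises and the value is 1 in any characteristic. *)
Lemma shift_coef1 (q v : 'X_{1..n}) : (forall i, q i = 0%N \/ v i = 0%N) ->
  (shift 'X_[q + v])@_(Wt v)@_q = 1.
Proof.
elim/mnm_ind: v => [_|i v IH h].
  rewrite addm0; have -> : Wt 0%MM = 0%MM.
    apply/mnmP => j.
    by rewrite mnm_sumE mnm0E big1 // => l _; rewrite mulmnE mnm0E muln0.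
  elim/mnm_ind: q => [|i q IH]; first by rewrite mpolyX0 rmorph1 mcoeff1 eqxx mcoeff1 eqxx.
  rewrite mcoeff_shiftS lem_addr addmC addmK IH.
  case: ifP => [/mnm_lepP le0|_]; last by rewrite addr0.
  have : wt i == 0%MM by apply/eqP/mnmP => j; have := le0 j; rewrite !mnm0E leqn0 => /eqP.
  by rewrite wt_neq0.
have qi : q i = 0%N.
  by case: (h i) => //; rewrite mnmDE mnm1E eqxx.
have -> : (q + (U_(i) + v) = U_(i) + (q + v))%MM by rewrite !addmA [(q + _)%MM]addmC.
rewrite mcoeff_shiftS lep1mP qi eqxx /= add0r mnm_weightD mnm_weightU.
rewrite lem_addr addmC addmK IH // => j; case: (h j) => [->|]; first by left.
by rewrite mnmDE => /eqP; rewrite addn_eq0 => /andP[_ /eqP]; right.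
Qed.

(** The exponents of [Wt A] are the total of the quotients [i %/ c] and the number of factors in
    each residue class modulo [c]. Both sides are linear functions of these. *)
Lemma Wt_invariant (A B : 'X_{1..n}) (a : nat) (g : nat -> nat) : Wt A = Wt B ->
  (\sum_(i < n) A i * (a * (i %/ c) + g (i %% c)) =
   \sum_(i < n) B i * (a * (i %/ c) + g (i %% c)))%N.
Proof.
move=> e.
have key (D : 'X_{1..n}) : (\sum_(i < n) D i * (a * (i %/ c) + g (i %% c)) =
    a * Wt D ord0 + \sum_(r < c) g r * Wt D (lift ord0 r))%N.
  rewrite mnm_sumE big_distrr /=.
  under [X in (_ = _ + X)%N]eq_bigr => r _ do rewrite mnm_sumE big_distrr /=.
  rewrite exchange_big /= -big_split; apply: eq_bigr => i _ /=.
  have hr : (i %% c < c)%N by rewrite ltn_mod.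
  rewrite (bigD1 (Ordinal hr)) //= big1 ?addn0.
    rewrite !mulmnE /wt !mnmDE !mulmnE !mnm1E /=.
    rewrite (_ : inord _ == ord0 = false); last first.
      by apply/eqP => /(congr1 val); rewrite /= inordK.
    rewrite (_ : inord _ == lift _ _); last first.
      by apply/eqP/val_inj; rewrite /= inordK.
    lia.
  move=> r nr; rewrite mulmnE /wt mnmDE mulmnE !mnm1E /=.
  rewrite (_ : inord _ == lift _ _ = false) ?muln0 //.
  apply/eqP => /(congr1 val); rewrite /= inordK // /bump leq0n add1n => -[er].
  by move/eqP: nr; apply; apply: val_inj.
by rewrite !key e.
Qed.

(** The sum is [(x - p) %/ c + p %/ c + 1], written as a quotient plus a function of the residue
    because [Wt_invariant] admits only weights of this shape. *)
Lemma window_div p x : (p <= x)%N ->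
  if (x < p + c)%N then (x %/ c + (p %% c <= x %% c) = (p %/ c).+1)%N
  else if x == (p + c)%N then (x %/ c + (p %% c <= x %% c) = (p %/ c).+2)%N
  else ((p %/ c).+2 <= x %/ c + (p %% c <= x %% c))%N.
Proof.
move=> h; move: (divn_eq p c) (divn_eq x c) (ltn_pmod p c_gt0) (ltn_pmod x c_gt0).
move: (p %/ c)%N (p %% c)%N (x %/ c)%N (x %% c)%N => a r b s ep ex hr hs.
have h1 u v : (u < v -> u * c + c <= v * c)%N.
  by move=> uv; rewrite -mulSnr leq_mul2r uv orbT.
have h3 : (a * c + r <= b * c + s)%N by rewrite -ep -ex.
have ab : (a <= b)%N by rewrite leqNgt; apply/negP => /h1; lia.
have [hx|hx] := ltnP x (p + c).
  have hb : (b < a.+2)%N by rewrite ltnNge; apply/negP => /h1; rewrite mulSnr; lia.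
  have [e|e] : b = a \/ b = a.+1 by lia.
    by rewrite e in ex h3 *; lia.
  by rewrite e mulSnr in ex *; lia.
have ab' : (a < b)%N.
  by rewrite ltn_neqAle ab andbT; apply/eqP => e; rewrite -e in ex; lia.
case: eqP => e.
  have hb : (b < a.+2)%N.
    by rewrite ltnNge; apply/negP => /h1; rewrite mulSnr; lia.
  have e' : b = a.+1 by lia.
  by rewrite e' mulSnr in ex *; lia.
have [h4|h4] := leqP a.+2 b; first lia.
have e' : b = a.+1 by lia.
by rewrite e' mulSnr in ex *; lia.
Qed.

(* Among the monomials with a given value at [y], the one supported in a window
   of length [c + 1] is the smallest: swapping [x_i x_j] for [x_(i+c) x_(j-c)]
   does not change the value. *)
Lemma window_min p (A B : 'X_{1..n}) :
  (forall i : 'I_n, A i != 0%N -> (p <= i <= p + c)%N) -> Wt B = Wt A -> (A <= B)%O.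
Proof.
move=> hA e; rewrite leNgt; apply/negP => lt.
have deg : mdeg B = mdeg A.
  have e1 (D : 'X_{1..n}) : mdeg D = (\sum_(i < n) D i * (0 * (i %/ c) + 1))%N.
    by rewrite mdegE; apply: eq_bigr => i _; rewrite muln1.
  by rewrite !e1; apply: (Wt_invariant 0%N (fun=> 1%N) e).
move/ltmcP: lt => /(_ deg)[y eqy lty].
have Ay : A y != 0%N by lia.
have /andP[py yp] := hA _ Ay.
(* A potential argument: [phi] has equal totals on [A] and [B], and so has the constant [kap]. Hence
   the integers [(A i - B i) * (phi i - kap)] sum to zero, although they vanish before [y], are
   negative at [y] and are at most zero after it. *)
have contra (phi : nat -> nat) kap :
    (\sum_(i < n) B i * phi i = \sum_(i < n) A i * phi i)%N ->
    (forall i : 'I_n, (y < i)%N -> A i * phi i + B i * kap <= B i * phi i + A i * kap)%N ->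
    (phi y < kap)%N -> False.
  move=> ephi le1 lt1.
  suff : (\sum_(i < n) (A i * phi i + B i * kap) <
          \sum_(i < n) (B i * phi i + A i * kap))%N.
    rewrite !big_split /= -!big_distrl /= -!mdegE deg ephi ltnn //.
  rewrite (bigD1 y) //= [ltnRHS](bigD1 y) //= -addSn leq_add //; first by nia.
  apply: leq_sum => i hi; have [h|h] := ltnP i y; first by rewrite (eqy _ h).
  by apply: le1; rewrite ltn_neqAle h andbT eq_sym; exact: hi.
have A0 (i : 'I_n) : (p + c < i)%N -> A i = 0%N.
  by move=> h; apply/eqP; apply: contraTT h => /hA; lia.
have [ypc|ypc] := eqVneq (nat_of_ord y) (p + c)%N.
  (* At the right end of the window the index itself is a potential, because [A] vanishes beyond. *)
  apply: (contra (fun x => x + 1)%N (p + c + 2)%N).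
  - have e1 (D : 'X_{1..n}) : (\sum_(i < n) D i * (i + 1) =
        \sum_(i < n) D i * (c * (i %/ c) + (i %% c + 1)))%N.
      by apply: eq_bigr => i _; rewrite addnA [(c * _)%N]mulnC -divn_eq.
    by rewrite !e1; apply: (Wt_invariant c (fun r => r + 1)%N e).
  - move=> i hi; rewrite A0 -?ypc // !mul0n addn0 add0n leq_mul2l; lia.
  - by rewrite ypc; lia.
have ylt : (y < p + c)%N by lia.
(* The corrections give the potential the value [p %/ c + 2] at [y], exactly [kap] on the rest of
   the window, and at least [kap] beyond it. They separate the residues of [p] and [y] from the
   others; the disjunction handles [y = p], whose residue returns at [p + c]. *)
pose ind r := (nat_of_bool (p %% c <= r) + nat_of_bool (r != p %% c)%N
   + nat_of_bool ((r != y %% c) || (y == p :> nat)))%N.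
apply: (contra (fun x => 1 * (x %/ c) + ind (x %% c))%N (p %/ c + 3)%N).
- exact: Wt_invariant e.
- move=> i hi; rewrite /ind mul1n.
  have pi : (p <= i)%N by lia.
  have neqmod (x z : nat) : (x < z)%N -> (z < x + c)%N -> (z %% c == x %% c)%N = false.
    move=> h1 h2; apply/negbTE/negP; rewrite eqn_mod_dvd ?(ltnW h1) //.
    by move/dvdn_leq; lia.
  have := window_div pi; case: ifP => h1; last case: ifP => h2.
  + have -> /= : (i %% c != p %% c)%N by rewrite neqmod //; lia.
    have -> /= : (i %% c != y %% c)%N by rewrite neqmod //; lia.
    by nia.
  + move/eqP: h2 => h2; have hm : (i %% c = p %% c)%N by rewrite h2 modnDr.
    rewrite hm eqxx /=.
    have -> : ((p %% c != y %% c)%N || (y == p :> nat)).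
      have [->|yp0] := eqVneq (nat_of_ord y) p; first by rewrite orbT.
      by rewrite eq_sym neqmod //; lia.
    nia.
  + rewrite A0; last lia.
    have hpos : (1 <= (i %% c != p %% c) + ((i %% c != y %% c) || (y == p :> nat)))%N.
      have [->|//] := eqVneq (i %% c)%N (p %% c)%N.
      have [->|yp0] := eqVneq (nat_of_ord y) p; first by rewrite orbT.
      by rewrite eq_sym neqmod //; lia.
    by move=> hd; rewrite !mul0n addn0 add0n leq_mul2l; apply/orP; right; lia.
- rewrite /ind mul1n eqxx /=; have := window_div py; rewrite ylt.
  by have [->|yp0] := eqVneq (nat_of_ord y) p; rewrite ?eqxx /=; lia.
Qed.

End Substitution.

(** * Leading monomials in ideals of minors *)

Section LeadingMonomials.
Variables (K : fieldType) (n c : nat).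
Hypothesis c_gt0 : (0 < c)%N.

Local Notation Wt := (mnm_weight (fun i : 'I_n => wt c i)).
Local Notation shiftp := (@shift K n c).
Local Notation gmin := (@gminor K n c).
Local Notation Jid := (@Jideal K n c).

(** The degree in the [u_r] alone. Every [y_i] is linear in them, whatever its power of [s], so
    [udeg] counts the variables replaced by [y]. *)
Definition udeg (m : 'X_{1..c.+1}) : nat := (\sum_(r < c) m (lift ord0 r))%N.

Lemma udegD m1 m2 : udeg (m1 + m2)%MM = (udeg m1 + udeg m2)%N.
Proof. by rewrite /udeg -big_split; apply: eq_bigr => r _; rewrite mnmDE. Qed.

Lemma udeg0 : udeg 0%MM = 0%N.
Proof. by rewrite /udeg big1 // => r _; rewrite mnm0E. Qed.

Lemma udegMn m k : udeg (m *+ k)%MM = (udeg m * k)%N.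
Proof. by rewrite /udeg big_distrl; apply: eq_bigr => r _; rewrite mulmnE. Qed.

Lemma udegU0 k : udeg (U_(ord0) *+ k)%MM = 0%N.
Proof. by rewrite udegMn /udeg big1 // => r _; rewrite mnm1E. Qed.

Lemma udeg_wt x : udeg (wt c x) = 1%N.
Proof.
have hr : (x %% c < c)%N by rewrite ltn_mod.
rewrite udegD udegU0 add0n /udeg (bigD1 (Ordinal hr)) //= big1 ?addn0.
  by rewrite mnm1E (_ : inord _ == lift _ _) //; apply/eqP/val_inj; rewrite /= inordK.
move=> r nr; rewrite mnm1E; apply/eqP; rewrite eqb0; apply/eqP => /(congr1 val).
rewrite /= inordK // /bump leq0n add1n => -[er].
by move/eqP: nr; apply; apply: val_inj.
Qed.

Lemma udeg_Wt A : udeg (Wt A) = mdeg A.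
Proof.
rewrite /mnm_weight mdegE.
transitivity (\sum_(i < n) udeg (wt c i *+ A i)%MM)%N.
  by elim/big_rec2: _ => [|i a b _ <-]; rewrite ?udeg0 ?udegD.
by apply: eq_bigr => i _; rewrite udegMn udeg_wt mul1n.
Qed.

Definition udeg_le d (F : {mpoly {mpoly K[n]}[c.+1]}) :=
  forall m, m \in msupp F -> (udeg m <= d)%N.

Lemma udeg_leD d F G : udeg_le d F -> udeg_le d G -> udeg_le d (F + G).
Proof. by move=> hF hG m /msuppD_le; rewrite mem_cat => /orP[/hF|/hG]. Qed.

Lemma udeg_leM d e F G : udeg_le d F -> udeg_le e G -> udeg_le (d + e) (F * G).
Proof.
move=> hF hG m /msuppM_le/allpairsP[[m1 m2] /= [/hF h1 /hG h2 ->]].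
by rewrite udegD leq_add.
Qed.

Lemma udeg_leC d a : udeg_le d a%:MP.
Proof.
move=> m; rewrite msuppC; case: ifP => // _; rewrite inE => /eqP ->.
by rewrite udeg0.
Qed.

Lemma udeg_leX d m : (udeg m <= d)%N -> udeg_le d 'X_[m].
Proof. by move=> h m'; rewrite msuppX inE => /eqP ->. Qed.

Lemma udeg_le_sum d (I : Type) (r : seq I) F :
  (forall i, udeg_le d (F i)) -> udeg_le d (\sum_(i <- r) F i).
Proof.
move=> h; elim/big_ind: _ => //; first by move=> m; rewrite msupp0.
exact: udeg_leD.
Qed.

Definition coefJ t (F : {mpoly {mpoly K[n]}[c.+1]}) := forall m, Jid t F@_m.

Lemma coefJ_ideal t : is_ideal (coefJ t).
Proof.
have [J0 JD JM] := ideal_gen_ideal (@minors K n c t).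
split=> [m|F G hF hG m|F G hG m]; first by rewrite mcoeff0.
  by rewrite mcoeffD; apply: JD (hF m) (hG m).
rewrite mcoeffM; elim/big_ind: _ => [//|x y hx hy|k _]; first exact: JD.
by apply: JM; apply: hG.
Qed.

Lemma coefJC t a : Jid t a -> coefJ t a%:MP.
Proof.
move=> h m; rewrite mcoeffC mulrC.
by have [_ _ JM] := ideal_gen_ideal (@minors K n c t); apply: JM.
Qed.

Lemma wtMD f g : wt c (f * c + g) = (U_(ord0) *+ f + wt c g)%MM.
Proof.
rewrite /wt divnMDl // modnMDl addmA; congr (_ + _)%MM.
by apply/mnmP => i; rewrite mnmDE !mulmnE mulnDr.
Qed.

Local Notation nmx f g := (\matrix_(i, j) nvar K n (f i * c + g j)).

(** By [wtMD] the shift adds to the matrix the product of the column [s^(f i)] and the row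
    [y_(g j)]. A determinant is affine linear along such a rank-one update. *)
Lemma shift_gminor t (f g : 'I_t -> nat) : in_range n c f g ->
  shiftp (gmin f g) = (gmin f g)%:MP +
    \sum_j (\sum_i 'X_[wt c (g i)] * (cofactor (nmx f g) j i)%:MP) * 'X_[U_(ord0) *+ f j].
Proof.
move=> hr; rewrite /gminor -det_map_mx.
pose a : 'cV[{mpoly {mpoly K[n]}[c.+1]}]_t := \col_i 'X_[U_(ord0) *+ f i].
pose b : 'rV[{mpoly {mpoly K[n]}[c.+1]}]_t := \row_j 'X_[wt c (g j)].
have -> : map_mx shiftp (nmx f g) = map_mx (@mpolyC c.+1 _) (nmx f g) + a *m b.
  apply/matrixP => i j; rewrite !mxE big_ord1 !mxE shift_nvar //; congr (_ + _).
  by rewrite wtMD mpolyXD.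
rewrite det_map_add_rank1.
congr (_ + _); apply: eq_bigr => j _; rewrite mxE; congr (_ * _).
by apply: eq_bigr => i _; rewrite mxE.
Qed.

Lemma udeg_shift_gminor t (f g : 'I_t -> nat) : in_range n c f g ->
  udeg_le 1 (shiftp (gmin f g)).
Proof.
move=> hr; rewrite shift_gminor //; apply: udeg_leD; first exact: udeg_leC.
apply: udeg_le_sum => j; rewrite -[1%N]/(1 + 0)%N; apply: udeg_leM; last first.
  by apply: udeg_leX; rewrite udegU0.
apply: udeg_le_sum => i; rewrite -[1%N]/(1 + 0)%N; apply: udeg_leM; last exact: udeg_leC.
by apply: udeg_leX; rewrite udeg_wt.
Qed.

Lemma strict_lift t (f : 'I_t.+1 -> nat) j : strict f -> strict (f \o lift j).
Proof.
have bump_lt (d a b : nat) : (a < b -> bump d a < bump d b)%N.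
  by rewrite /bump; case: (leqP d a); case: (leqP d b); lia.
by move=> hf x y h; apply: hf; apply: bump_lt.
Qed.

Lemma cofactor_minor t (f g : 'I_t.+1 -> nat) i j : strict f -> strict g ->
  in_range n c f g -> Jid t (cofactor (nmx f g) i j).
Proof.
move=> hf hg hr; have [_ _ JM] := ideal_gen_ideal (@minors K n c t).
apply: JM; apply: ideal_gen_incl; exists (f \o lift i), (g \o lift j).
split; [exact: strict_lift|exact: strict_lift|by move=> x y; apply: hr|].
by congr determinant; apply/matrixP => x y; rewrite !mxE.
Qed.

Lemma Jideal_shift t p : Jid t.+1 p -> coefJ t (shiftp p).
Proof.
have [J0 JD JM] := ideal_gen_ideal (@minors K n c t).
have [C0 CD CM] := coefJ_ideal t.
move: p; apply: (@ideal_gen_sub _ _ (fun p => coefJ t (shiftp p))).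
  split; first by rewrite raddf0.
    by move=> a b; rewrite raddfD; apply: CD.
  by move=> r a h; rewrite rmorphM; apply: CM.
move=> _ [f [g [hf hg hr ->]]]; rewrite shift_gminor //; apply: CD.
  apply: coefJC; rewrite /gminor (expand_det_row _ ord0).
  apply: ideal_sum => [|j _]; first exact: ideal_gen_ideal.
  by apply: JM; apply: cofactor_minor.
apply: ideal_sum => [|j _]; first exact: coefJ_ideal.
rewrite mulrC; apply: (CM); apply: ideal_sum => [|i _]; first exact: coefJ_ideal.
by apply: CM; apply: coefJC; apply: cofactor_minor.
Qed.

Lemma Jideal_coef0 t p : Jid t.+1 p -> p@_0%MM = 0.
Proof.
move: p; apply: (@ideal_gen_sub _ _ (fun p => p@_0%MM = 0)).
  split=> [|a b ha hb|r a ha]; first by rewrite mcoeff0.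
    by rewrite mcoeffD ha hb addr0.
  by rewrite rmorphM /= ha mulr0.
move=> _ [f [g [hf hg hr ->]]]; rewrite /gminor -det_map_mx /=.
rewrite (_ : map_mx _ _ = 0) ?det0 //; apply/matrixP => i j.
rewrite !mxE nvarE // mcoeffX.
by rewrite -[(_ + _)%N]/(nat_of_ord (Ordinal (hr i j))) nX_ord mnm1_eq0.
Qed.

Definition window p (m : 'X_{1..n}) : 'X_{1..n} :=
  [multinom (if (p <= i <= p + c)%N then m i else 0%N) | i < n].
Definition unwindow p (m : 'X_{1..n}) : 'X_{1..n} :=
  [multinom (if (p <= i <= p + c)%N then 0%N else m i) | i < n].

Lemma windowK p m : (unwindow p m + window p m)%MM = m.
Proof.
by apply/mnmP => i; rewrite mnmDE !mnmE; case: ifP => _; rewrite ?addn0.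
Qed.

Lemma ev_window p m x : ev (window p m) x = if (p <= x <= p + c)%N then ev m x else 0%N.
Proof.
have [hx|hx] := ltnP x n; last by rewrite !ev_out // if_same.
by rewrite -[x]/(nat_of_ord (Ordinal hx)) !ev_ord mnmE.
Qed.

Lemma ev_unwindow p m x : ev (unwindow p m) x = if (p <= x <= p + c)%N then 0%N else ev m x.
Proof.
have [hx|hx] := ltnP x n; last by rewrite !ev_out // if_same.
by rewrite -[x]/(nat_of_ord (Ordinal hx)) !ev_ord mnmE.
Qed.

(** Any monomial of [f] that contributes is [unwindow p mu] times some [v'] with the same value at
    [y] as the window. By [window_min] it is at least [mu], hence equal to the leading monomial, so
    nothing cancels. *)
Lemma mcoeff_window p f mu : f != 0 -> mlead f = mu ->
  (shiftp f)@_(Wt (window p mu))@_(unwindow p mu) = f@_mu.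
Proof.
move=> f0 lf; have coef1 : (shiftp 'X_[mu])@_(Wt (window p mu))@_(unwindow p mu) = 1.
  have := @shift_coef1 K n c (unwindow p mu) (window p mu); rewrite windowK; apply=> i.
  by rewrite !mnmE; case: ifP; [left|right].
have muf : mu \in msupp f by rewrite -lf mlead_supp.
rewrite mcoeff_shift (bigD1_seq mu muf (msupp_uniq f)).
transitivity (f@_mu * 1 + 0); last by rewrite mulr1 addr0.
congr (_ * _ + _); first exact: coef1.
rewrite big_seq_cond big1 // => v /andP[hv nv].
case: (eqVneq ((shiftp 'X_[v])@_(Wt (window p mu))@_(unwindow p mu)) 0) => [e0|].
  by rewrite [X in _ * X]e0 mulr0.
move=> /shift_supp[v' [e1 e2]].
have le1 : (window p mu <= v')%O.
  apply: (window_min (p := p) c_gt0) e2 => i; rewrite mnmE; by case: ifP.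
have le2 : (v <= mu)%O by rewrite -lf; apply: msupp_le_mlead.
case/negP: nv; rewrite eq_le le2 e1 -{1}(windowK p mu).
by rewrite lemc_add2r.
Qed.

Lemma mlead_window p f mu : f != 0 -> mlead f = mu ->
  mlead (shiftp f)@_(Wt (window p mu)) = unwindow p mu.
Proof.
move=> f0 lf; apply: mlead_eq; first by rewrite mcoeff_window // -lf mleadc_eq0.
move=> q; rewrite mcoeff_msupp mcoeff_shift => h; rewrite leNgt; apply/negP => lt.
case/negP: h; apply/eqP; rewrite big_seq big1 // => v hv.
case: (eqVneq ((shiftp 'X_[v])@_(Wt (window p mu))@_q) 0) => [e0|].
  by rewrite [X in _ * X]e0 mulr0.
move=> /shift_supp[v' [e1 e2]].
have le1 : (window p mu <= v')%O.
  apply: (window_min (p := p) c_gt0) e2 => i; rewrite mnmE; by case: ifP.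
have : (v <= mu)%O by rewrite -lf; apply: msupp_le_mlead.
rewrite leNgt e1 -{1}(windowK p mu) => /negP[]; exact: ltmc_le_add.
Qed.

Definition pcount (m : 'X_{1..n}) x : nat := (\sum_(0 <= y < x) ev m y)%N.

Lemma pcountS m x : pcount m x.+1 = (pcount m x + ev m x)%N.
Proof. by rewrite /pcount big_nat_recr. Qed.

Lemma pcount_mdeg m x : (n <= x)%N -> pcount m x = mdeg m.
Proof.
move=> h; rewrite /pcount (big_cat_nat (n := n)) //= [X in (_ + X)%N]big_nat_cond.
rewrite [X in (_ + X)%N]big1 ?addn0; last by move=> y /andP[/andP[hy _] _]; rewrite ev_out.
by rewrite big_mkord mdegE; apply: eq_bigr => i _; rewrite ev_ord.
Qed.

Lemma pcount_window m p : (pcount m (p + c.+1) = pcount m p + mdeg (window p m))%N.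
Proof.
rewrite -(@pcount_mdeg _ (n + (p + c.+1))) ?leq_addr // /pcount.
rewrite (big_cat_nat (n := p)) ?leq_addr //=; congr (_ + _)%N.
have le_p : (p <= n + (p + c.+1))%N by lia.
rewrite [RHS](big_cat_nat (leq0n p) le_p) /=.
rewrite [X in (_ = X + _)%N]big_nat_cond [X in (_ = X + _)%N]big1 ?add0n; last first.
  by move=> y /andP[/andP[_ h] _]; rewrite ev_window leqNgt h.
rewrite [RHS](big_cat_nat (n := (p + c.+1)%N)) ?leq_addl ?leq_addr //=.
rewrite [X in (_ = _ + X)%N]big_nat_cond [X in (_ = _ + X)%N]big1 ?addn0; last first.
  by move=> y /andP[/andP[h _] _]; rewrite ev_window ifF //; lia.
rewrite big_nat_cond [RHS]big_nat_cond; apply: eq_bigr => y /andP[/andP[h1 h2] _].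
by rewrite ev_window ifT //; lia.
Qed.

Lemma lead_window_le d p f : f != 0 -> udeg_le d (shiftp f) ->
  (mdeg (window p (mlead f)) <= d)%N.
Proof.
move=> f0 h; rewrite -udeg_Wt; apply: h; rewrite mcoeff_msupp.
apply: contraTneq isT => e.
have e2 := congr1 (mcoeff (unwindow p (mlead f))) e; rewrite mcoeff0 in e2.
move: (etrans (esym (mcoeff_window p f0 erefl)) e2) => /eqP.
by rewrite mleadc_eq0 (negbTE f0).
Qed.

(** The last clause puts a chosen element, possibly [x] itself, in [[x - c, x]] for each [x]
    occurring in [m]: only the gap condition may cause an element to be skipped. *)
Definition greedy (m : 'X_{1..n}) T v :=
  [/\ chainf c n T v, forall x, (v x.+1 - v x <= ev m x)%N
    & forall x, (0 < ev m x)%N -> (v (x - c) < v x.+1)%N].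

(** The smallest index [p] in [m] is chosen and its window [[p, p + c]] removed. For [f] in the
    ideal of [t.+1]-minors, the coefficient of the shifted [f] at the removed part lies in the ideal
    of [t]-minors and has the remaining monomial as its lead, so the induction applies to it. The
    chain depends on [m] only. *)
Lemma greedy_lead m : exists T v, greedy m T v /\
  forall t f, Jid t f -> f != 0 -> mlead f = m -> (t <= T)%N.
Proof.
have [d] := ubnP (mdeg m); elim: d m => // d IH m hm.
have [->|m0] := eqVneq m 0%MM.
  exists 0%N, (fun=> 0%N); split; first by split=> // x; rewrite ev0.
  case=> // t f /Jideal_coef0 f0 nz e.
  by move: nz; rewrite -mleadc_eq0 e f0 eqxx.
have [p mp minp] : exists2 p : 'I_n, m p != 0%N & forall i : 'I_n, m i != 0%N -> (p <= i)%N.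
  have [j hj] : exists j, m j != 0%N.
    apply/existsP; apply: contraR m0 => /existsPn h; apply/eqP/mnmP => i.
    by rewrite mnm0E; apply/eqP; have := h i; rewrite negbK.
  by case: (arg_minnP (P := fun j => m j != 0%N) val hj) => p h0 h1; exists p.
have [T [v [[hv subv grv] ht]]] : exists T v, greedy (unwindow p m) T v /\
  forall t f, Jid t f -> f != 0 -> mlead f = unwindow p m -> (t <= T)%N.
  apply: IH; move: hm; rewrite -{1}(windowK p m) mdegD ltnS.
  have : (0 < mdeg (window p m))%N.
    rewrite mdegE (bigD1 p) //= mnmE leqnn leq_addr /=; lia.
  by lia.
have [v0 v1 v2 v3] := hv.
have evlt x : (x < p)%N -> ev m x = 0%N.
  move=> h; have hx : (x < n)%N by apply: ltn_trans h _.
  rewrite -[x]/(nat_of_ord (Ordinal hx)) ev_ord; apply/eqP; apply: contraTT h => /minp.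
  by rewrite -leqNgt.
have vz x : (x <= p + c.+1)%N -> v x = 0%N.
  elim: x => // x IHx hx; have := subv x; rewrite ev_unwindow.
  have := IHx (ltnW hx); case: ifP => h; first by lia.
  by rewrite evlt; [lia|lia].
exists T.+1, (fun x => v x + (p < x))%N; split; last first.
  case=> // t f hf f0 e; rewrite ltnS; apply: (ht t ((shiftp f)@_(Wt (window p m)))).
  - exact: Jideal_shift hf _.
  - apply: contraTneq isT => e0.
    have e2 := congr1 (mcoeff (unwindow p m)) e0; rewrite mcoeff0 in e2.
    move: (etrans (esym (mcoeff_window p f0 e)) e2) => /eqP.
    by rewrite -e mleadc_eq0 (negbTE f0).
  - exact: mlead_window.
split.
- split=> [|x|x|x hx].
  + by rewrite v0.
  + by have := v1 x; lia.
  + have := v2 x; case: (leqP x p) => hx; last by lia.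
    by rewrite (vz (x + c.+1)%N); [lia|lia].
  + by rewrite v3 // (_ : (p < x)%N) ?addn1 //; apply: leq_trans hx.
- move=> x; have := subv x; have := v1 x; rewrite ev_unwindow.
  have [->|nx] := eqVneq x p.
    rewrite leqnn leq_addr /= ev_ord ltnn ltnSn; lia.
  by case: ifP => h; [have := vz x; have := vz x.+1; lia|lia].
- move=> x hx; have px : (p <= x)%N by rewrite leqNgt; apply/negP => /evlt; lia.
  have [h|h] := leqP x (p + c).
    by rewrite (vz (x - c)%N); lia.
  have := grv x; rewrite ev_unwindow ifF; last lia.
  by move/(_ hx); lia.
Qed.

(** Ideal membership gives a greedy chain of length [T >= t], and the bound on [udeg] makes its
    complement a chain. The lengths [s + t - T] and [T] may be too far apart; [chainf_split]
    rebalances them. *)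
Theorem lead_two_chains s t f : (s <= t)%N -> f != 0 -> Jid t f ->
  udeg_le 2 (shiftp f) -> mdeg (mlead f) = (s + t)%N ->
  exists f1 f2, [/\ chainf c n s f1, chainf c n t f2 &
    forall x, (f1 x + f2 x = pcount (mlead f) x)%N].
Proof.
move=> st f0 hJ hU hd; set m := mlead f.
have [T [v [[hv subv grv] ht]]] := greedy_lead m.
have hT := ht t f hJ f0 erefl.
have [v0 v1 v2 v3] := hv.
have pn : pcount m n = (s + t)%N by rewrite pcount_mdeg.
have hu : chainf c n (pcount m n - T)%N (fun x => pcount m x - v x)%N.
  apply: greedy_complement hv _ _ _ _ _ _.
  - by rewrite /pcount big_geq.
  - by move=> x; rewrite pcountS; have := subv x; lia.
  - by move=> x; rewrite pcountS leq_addr.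
  - by move=> x; rewrite pcount_window leq_add2l; apply: lead_window_le.
  - by move=> x; rewrite pcountS => h; apply: grv; lia.
  - by move=> x hx; rewrite !pcount_mdeg.
have Tle : (T <= pcount m n)%N.
  have [_ _ _ h] := hu; have := chainf_le n hv.
  have le_v x : (v x <= pcount m x)%N.
    elim: x => [|x IHx]; first by rewrite v0.
    by rewrite pcountS; have := subv x; have := v1 x; lia.
  by have := le_v n; rewrite v3.
have [|||f1 [f2 [h1 h2 h3]]] := @chainf_split c n _ _ _ _ s t hu hv.
- by rewrite pn; lia.
- by [].
- by rewrite subnK.
exists f1, f2; split=> // x; rewrite h3 subnK //.
elim: x => [|x IHx]; first by rewrite v0.
by rewrite pcountS; have := subv x; have := v1 x; lia.
Qed.

End LeadingMonomials.

(** * The toric part *)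

Section Uniqueness.
Local Open Scope nat_scope.
Variables (N n c k : nat) (cls : 'I_N -> 'I_k.+1) (cnt : 'I_N -> nat -> nat).
Variable len : 'I_k.+1 -> nat.
Hypothesis cnt_chain : forall v, chainf c n (len (cls v)) (cnt v).
Hypothesis cnt_inj : forall v w, cls v = cls w -> cnt v =1 cnt w -> v = w.
Hypothesis cnt_surj : forall d f, chainf c n (len d) f -> exists v, cls v = d /\ cnt v =1 f.

Definition area v := \sum_(x < n.+1) cnt v x.
(** An effective exchange with positive offset lowers [w_square] by convexity. With offset zero the
    values are only swapped: then [w_class] rewards giving area to the larger class, and within a
    class [w_spread], concave in the area, rewards unequal areas. Its constant bounds every area
    ([area_le]), so the subtraction is exact. *)
Definition w_square v := \sum_(x < n.+1) cnt v x ^ 2.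
Definition w_class v := (k - cls v) * area v.
Definition w_spread v := area v * (n.+1 * n.+1 - area v).

Lemma cnt_le v x : cnt v x <= x.
Proof.
have [h0 _ _ _] := cnt_chain v.
by elim: x => [|x IH]; [rewrite h0|have := chainf_step x (cnt_chain v); lia].
Qed.

Lemma area_le v : area v <= n.+1 * n.+1.
Proof.
apply: (@leq_trans (\sum_(x < n.+1) n.+1)); last by rewrite sum_nat_const card_ord.
by apply: leq_sum => x _; have := cnt_le v x; have := ltn_ord x; lia.
Qed.

Definition better v' w' v w :=
  [\/ w_square v' + w_square w' < w_square v + w_square w,
   w_square v' + w_square w' = w_square v + w_square w /\
   w_class v' + w_class w' < w_class v + w_class w
   | [/\ w_square v' + w_square w' = w_square v + w_square w,
   w_class v' + w_class w' = w_class v + w_class w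
   & w_spread v' + w_spread w' < w_spread v + w_spread w]].

Definition tight v w := forall v' w', cls v' = cls v -> cls w' = cls w ->
  (forall x, cnt v' x + cnt w' x = cnt v x + cnt w x) -> ~ better v' w' v w.

Section Pair.
Variables v w : 'I_N.
Hypothesis vw : tight v w.

Lemma exchange th E : 0 < E ->
  (forall x, E <= x <= E + c -> cnt w x = cnt v x + th) ->
  exists v' w', [/\ cls v' = cls v, cls w' = cls w,
    cnt v' =1 raise th E (cnt v) (cnt w), cnt w' =1 lower th E (cnt v) (cnt w)
    & ~ better v' w' v w].
Proof.
move=> E0 gap.
have [v' [cv hv]] := cnt_surj (chainf_raise (cnt_chain v) (cnt_chain w) E0 gap).
have [w' [cw hw]] := cnt_surj (chainf_lower (cnt_chain v) (cnt_chain w) E0 gap).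
exists v', w'; split=> //; apply: vw => // x.
by rewrite hv hw raise_lower.
Qed.

Lemma w_square_lt v' w' x0 : x0 < n.+1 ->
  (forall x, cnt v' x ^ 2 + cnt w' x ^ 2 <= cnt v x ^ 2 + cnt w x ^ 2) ->
  cnt v' x0 ^ 2 + cnt w' x0 ^ 2 < cnt v x0 ^ 2 + cnt w x0 ^ 2 ->
  w_square v' + w_square w' < w_square v + w_square w.
Proof.
move=> hx le lt; rewrite /w_square -!big_split /= (bigD1 (Ordinal hx)) //=.
rewrite [ltnRHS](bigD1 (Ordinal hx)) //= -addSn leq_add // leq_sum //.
Qed.

(** Since [v] has the element [e] and [w] does not, the difference of the counts at [e] exceeds
    [th]. The exchange at [e.+1] therefore acts there and lowers the sum of squares. *)
Lemma tight_lead e th : 0 < th ->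
  (forall x, e.+1 <= x <= e.+1 + c -> cnt w x = cnt v x + th) ->
  cnt v e < cnt v e.+1 -> cnt w e.+1 <= cnt w e -> False.
Proof.
move=> th0 gap lt_v le_w; have [v' [w' [_ _ hv hw]]] := exchange (ltn0Sn e) gap.
apply; constructor 1.
have en : e < n.+1.
  rewrite ltnNge; apply/negP => h; have [_ _ _ f] := cnt_chain v.
  by move: lt_v; rewrite !f //; lia.
have := gap e.+1; rewrite leqnn leq_addr => /(_ isT) gE.
apply: (w_square_lt en) => [x|]; rewrite hv hw /raise /lower; last first.
  rewrite ltnSn; have -> : maxn (cnt v e) (cnt w e - th) = cnt w e - th by lia.
  have -> : minn (cnt w e) (cnt v e + th) = cnt v e + th by lia.
  by nia.
case: ifP => // _; case: (leqP (cnt w x) (cnt v x + th)) => h.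
  have -> : maxn (cnt v x) (cnt w x - th) = cnt v x by lia.
  by [].
have -> : maxn (cnt v x) (cnt w x - th) = cnt w x - th by lia.
by nia.
Qed.

End Pair.

Lemma raise0 E f g x : raise 0 E f g x = if x < E then maxn (f x) (g x) else f x.
Proof. by rewrite /raise subn0. Qed.

Lemma lower0 E f g x : lower 0 E f g x = if x < E then minn (g x) (f x) else g x.
Proof. by rewrite /lower addn0. Qed.

Lemma w_square_swap E v w v' w' : cnt v' =1 raise 0 E (cnt v) (cnt w) ->
  cnt w' =1 lower 0 E (cnt v) (cnt w) ->
  w_square v' + w_square w' = w_square v + w_square w.
Proof.
move=> hv hw; rewrite /w_square -!big_split; apply: eq_bigr => x _ /=.
rewrite hv hw raise0 lower0; case: ifP => // _.
by case: (leqP (cnt v x) (cnt w x)) => h; [rewrite addnC|].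
Qed.

Lemma area_swap E v w v' w' : cnt v' =1 raise 0 E (cnt v) (cnt w) ->
  cnt w' =1 lower 0 E (cnt v) (cnt w) -> area v' + area w' = area v + area w.
Proof.
move=> hv hw; rewrite /area -!big_split; apply: eq_bigr => x _ /=.
by rewrite hv hw raise_lower.
Qed.

Lemma area_lt v v' x0 : x0 < n.+1 -> (forall x, cnt v x <= cnt v' x) ->
  cnt v x0 < cnt v' x0 -> area v < area v'.
Proof.
move=> hx le lt; rewrite /area (bigD1 (Ordinal hx)) //=.
by rewrite [ltnRHS](bigD1 (Ordinal hx)) //= -addSn leq_add // leq_sum.
Qed.

Lemma raise0_ge E f g x : f x <= raise 0 E f g x.
Proof. by rewrite raise0; case: ifP => // _; rewrite leq_maxl. Qed.

Lemma tight_class v w e : tight v w -> cls w < cls v ->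
  (forall x, e.+1 <= x <= e.+1 + c -> cnt w x = cnt v x) ->
  cnt v e < cnt v e.+1 -> cnt w e.+1 <= cnt w e -> False.
Proof.
move=> vw cvw gap lt_v le_w.
have [|v' [w' [cv cw hv hw]]] := exchange vw (th := 0) (ltn0Sn e).
  by move=> x hx; rewrite gap ?addn0.
apply; constructor 2; split; first exact: w_square_swap hv hw.
have en : e < n.+1.
  rewrite ltnNge; apply/negP => h; have [_ _ _ f] := cnt_chain v.
  by move: lt_v; rewrite !f //; lia.
have := gap e.+1; rewrite leqnn leq_addr => /(_ isT) gE.
have lt_area : area v < area v'.
  apply: (area_lt en) => [x|]; first by rewrite hv raise0_ge.
  by rewrite hv raise0 ltnSn; lia.
have := area_swap hv hw; rewrite /w_class cv cw.
have := ltn_ord (cls v); move: (cls v : nat) (cls w : nat) cvw => i j ij ik.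
move: lt_area; move: (area v) (area w) (area v') (area w') => A1 A2 B1 B2 h1 h2.
have -> : k - j = k - i + (i - j) by lia.
have -> : B2 = A1 + A2 - B1 by lia.
rewrite !mulnDl !addnA -!mulnDr; have -> : B1 + (A1 + A2 - B1) = A1 + A2 by lia.
by rewrite ltn_add2l ltn_pmul2l; lia.
Qed.

(** Cutting beyond [n] replaces the pair by its pointwise maximum and minimum. For an incomparable
    pair the maximum has larger area than both, while the total area is fixed, so [w_spread] would
    drop. *)
Lemma tight_same_class v w : tight v w -> cls v = cls w ->
  (forall x, cnt v x <= cnt w x) \/ (forall x, cnt w x <= cnt v x).
Proof.
move=> vw cvw.
have out u x : cls u = cls v -> n < x -> cnt u x = len (cls v).
  by move=> e h; have [_ _ _ f] := cnt_chain u; rewrite f ?e // ltnW.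
have [h1|/forallPn[x1]] := boolP [forall x : 'I_n.+1, cnt v x <= cnt w x].
  left=> x; have [hx|hx] := ltnP x n.+1; last by rewrite !out.
  by have := forallP h1 (Ordinal hx).
have [h2 _|/forallPn[x2]] := boolP [forall x : 'I_n.+1, cnt w x <= cnt v x].
  right=> x; have [hx|hx] := ltnP x n.+1; last by rewrite !out.
  by have := forallP h2 (Ordinal hx).
rewrite -!ltnNge => h2 h1.
have [|v' [w' [cv cw hv hw]]] := exchange vw (th := 0) (ltn0Sn n).
  by move=> x /andP[hx _]; rewrite !out ?addn0.
case; constructor 3; split; first exact: w_square_swap hv hw.
  by rewrite /w_class cv cw -cvw -!mulnDr (area_swap hv hw).
have a1 : area v < area v'.
  apply: (area_lt (ltn_ord x2)) => [x|]; first by rewrite hv raise0_ge.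
  by rewrite hv raise0 ltn_ord; lia.
have a2 : area w < area v'.
  apply: (area_lt (ltn_ord x1)) => [x|].
    rewrite hv raise0; case: ifP => hx; first by rewrite leq_maxr.
    by rewrite !out // ltnNge -ltnS hx.
  by rewrite hv raise0 ltn_ord; lia.
have := area_swap hv hw; rewrite /w_spread.
have := area_le v; have := area_le w; have := area_le v'; have := area_le w'.
move: a1 a2; move: (area v) (area w) (area v') (area w') (n.+1 * n.+1) => A1 A2 B1 B2 M.
move=> h3 h4 l1 l2 l3 l4 e; rewrite !mulnBr.
have s : A1 * A1 + A2 * A2 < B1 * B1 + B2 * B2 by nia.
have p1 : A1 * A1 <= A1 * M by rewrite leq_mul2l l4 orbT.
have p2 : A2 * A2 <= A2 * M by rewrite leq_mul2l l3 orbT.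
have p3 : B1 * B1 <= B1 * M by rewrite leq_mul2l l2 orbT.
have p4 : B2 * B2 <= B2 * M by rewrite leq_mul2l l1 orbT.
have : B1 * M + B2 * M = A1 * M + A2 * M by rewrite -!mulnDl e.
lia.
Qed.

Definition total_cnt (u : 'X_{1..N}) x := \sum_v u v * cnt v x.

Definition all_tight (u : 'X_{1..N}) :=
  forall v w, v != w -> 0 < u v -> 0 < u w -> tight v w.

Definition same_above E v w := cls v = cls w /\ forall x, E <= x -> cnt v x = cnt w x.

(** A finite encoding of the relation [same_above E], so that sums over variables can be partitioned
    by it. [inord] is faithful since [cnt v x <= x]. *)
Definition key E v : 'I_k.+1 * {ffun 'I_n.+1 -> 'I_n.+1} :=
  (cls v, [ffun x : 'I_n.+1 => if E <= x then inord (cnt v x) else ord0]).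

Lemma keyP E v w : key E v = key E w <-> same_above E v w.
Proof.
split=> [[cvw /ffunP h]|[cvw h]]; last first.
  congr pair => //; apply/ffunP => x; rewrite !ffunE; case: ifP => // /h -> //.
split=> // x hx; have [xn|xn] := ltnP x n.+1; last first.
  have [_ _ _ f] := cnt_chain v; have [_ _ _ g] := cnt_chain w.
  by rewrite f ?g ?cvw // ltnW.
have := h (Ordinal xn); rewrite !ffunE /= hx => /(congr1 val) /=.
by rewrite !inordK //; [have := cnt_le w x; lia|have := cnt_le v x; lia].
Qed.

Section Contradiction.
Variables (e : nat) (v1 v2 v3 v4 : 'I_N).
Hypotheses (s12 : same_above e.+1 v1 v2) (s34 : same_above e.+1 v3 v4).
Hypothesis diff : ~ same_above e.+1 v1 v3.
Hypotheses (in1 : cnt v1 e < cnt v1 e.+1) (in3 : cnt v3 e < cnt v3 e.+1).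
Hypotheses (out2 : cnt v2 e.+1 <= cnt v2 e) (out4 : cnt v4 e.+1 <= cnt v4 e).
Hypotheses (t14 : tight v1 v4) (t32 : tight v3 v2).

Lemma unblocked v : cnt v e < cnt v e.+1 ->
  forall x, e.+1 <= x <= e.+1 + c -> cnt v x = cnt v e.+1.
Proof.
move=> h x hx; have [_ _ f _] := cnt_chain v; have := f e.
have := chainf_mono (x := e.+1) (y := x) (cnt_chain v).
have := chainf_mono (x := x) (y := e + c.+1) (cnt_chain v).
by lia.
Qed.

(** All four counts are constant on [[e.+1, e.+1 + c]], so each pair can be cut at [e.+1]. The lower
    of [v1] and [v3] there, or at equal height the one of larger class, gains from an exchange. In
    the remaining case both pairs are comparable, which forces [v1] and [v3] to agree from [e.+1]
    on. *)
Lemma no_double_exchange : False.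
Proof.
have [c12 h12] := s12; have [c34 h34] := s34.
have b1 := unblocked in1; have b3 := unblocked in3.
have b2 x : e.+1 <= x <= e.+1 + c -> cnt v2 x = cnt v1 e.+1.
  by move=> hx; rewrite -h12 ?b1 //; case/andP: hx.
have b4 x : e.+1 <= x <= e.+1 + c -> cnt v4 x = cnt v3 e.+1.
  by move=> hx; rewrite -h34 ?b3 //; case/andP: hx.
case: (ltngtP (cnt v1 e.+1) (cnt v3 e.+1)) => h.
- apply: (@tight_lead _ _ t14 e (cnt v3 e.+1 - cnt v1 e.+1)) => //; first lia.
  by move=> x hx; rewrite b4 // b1 //; lia.
- apply: (@tight_lead _ _ t32 e (cnt v1 e.+1 - cnt v3 e.+1)) => //; first lia.
  by move=> x hx; rewrite b2 // b3 //; lia.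
case: (ltngtP (cls v1) (cls v3)) => hc.
- apply: (tight_class t32) in3 out2; first by rewrite -c12.
  by move=> x hx; rewrite b2 ?b3.
- apply: (tight_class t14) in1 out4; first by rewrite -c34.
  by move=> x hx; rewrite b4 ?b1.
have c13 : cls v1 = cls v3 by apply: val_inj.
have e1 : cnt v2 e.+1 = cnt v1 e.+1 by rewrite h12.
have e3 : cnt v4 e.+1 = cnt v3 e.+1 by rewrite h34.
have le14 : forall x, cnt v1 x <= cnt v4 x.
  case: (tight_same_class t14) => //; first by rewrite c13.
  by move=> /(_ e); lia.
have le32 : forall x, cnt v3 x <= cnt v2 x.
  case: (tight_same_class t32) => //; first by rewrite -c13.
  by move=> /(_ e); lia.
apply: diff; split=> // x hx.
by have := le14 x; have := le32 x; rewrite -h12 // -h34 //; lia.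
Qed.

End Contradiction.

Lemma exists_lt (T : finType) (a b : T -> nat) : \sum_x a x = \sum_x b x ->
  (exists x, a x != b x) -> exists x, a x < b x.
Proof.
move=> e [x hx]; apply/existsP; apply: contraT => /existsPn h.
have lt : b x < a x by have := h x; lia.
have : \sum_x b x < \sum_x a x.
  rewrite (bigD1 x) //= [ltnRHS](bigD1 x) //= -addSn leq_add //.
  by apply: leq_sum => y _; have := h y; lia.
by rewrite e ltnn.
Qed.

Lemma sum_gt0_ex (u : 'X_{1..N}) (Q : pred 'I_N) :
  0 < \sum_(v | Q v) u v -> exists2 v, Q v & 0 < u v.
Proof.
move=> h; have : \sum_(v | Q v) u v != 0 by rewrite -lt0n.
by rewrite sum_nat_eq0 => /forallPn[v]; rewrite negb_imply -lt0n => /andP[]; exists v.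
Qed.

(** Chains are rebuilt from the right: by descending induction both monomials have equally many
    factors of each class and tail. Equal content gives equally many factors containing [e]. If
    these were attached to different tails, one tail would have an excess in [u] and another in
    [u'], the configuration of [no_double_exchange]. *)
Theorem tight_unique (u u' : 'X_{1..N}) : all_tight u -> all_tight u' ->
  mnm_weight (fun v => U_(cls v)%MM) u = mnm_weight (fun v => U_(cls v)%MM) u' ->
  total_cnt u =1 total_cnt u' -> u = u'.
Proof.
move=> tu tu' ecls etot.
pose nk (m : 'X_{1..N}) E kap := \sum_(v | key E v == kap) m v.
suff H d : forall e, n = e + d -> forall kap, nk u e kap = nk u' e kap.
  apply/mnmP => v; have := H n 0 (esym (add0n n)) (key 0 v).
  have one m : nk m 0 (key 0 v) = m v.
    rewrite /nk (big_pred1 v) // => w; apply/eqP/eqP => [/keyP[h1 h2]|-> //].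
    by apply: cnt_inj => // x; apply: h2.
  by rewrite !one.
have base : forall kap, nk u n kap = nk u' n kap.
  move=> kap; have keyn v w : (key n v == key n w) = (cls v == cls w).
    apply/eqP/eqP => [/keyP[] //|h]; apply/keyP; split=> // x hx.
    have [_ _ _ f] := cnt_chain v; have [_ _ _ g] := cnt_chain w.
    by rewrite f ?g ?h.
  have [/existsP[w /eqP <-]|/existsPn no] := boolP [exists w, key n w == kap].
    have eq m : nk m n (key n w) = mnm_weight (fun v => U_(cls v)%MM) m (cls w).
      rewrite mnm_sumE /nk big_mkcond; apply: eq_bigr => v _.
      by rewrite mulmnE mnm1E keyn; case: eqP => _; rewrite ?mul1n ?mul0n.
    by rewrite !eq ecls.
  by rewrite /nk !big_pred0 // => v; apply/negbTE/no.
elim: d => [e|d IH e dE kap]; first by rewrite addn0 => <-.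
have {}IH : forall kap, nk u e.+1 kap = nk u' e.+1 kap by apply: IH; lia.
pose ins v := cnt v e < cnt v e.+1.
pose ni (m : 'X_{1..N}) kap := \sum_(v | (key e.+1 v == kap) && ins v) m v.
pose no (m : 'X_{1..N}) kap := \sum_(v | (key e.+1 v == kap) && ~~ ins v) m v.
have split_nk m kap' : nk m e.+1 kap' = ni m kap' + no m kap'.
  by rewrite /nk (bigID ins).
have tot_ni m : \sum_kap' ni m kap' = total_cnt m e.+1 - total_cnt m e.
  transitivity (\sum_(v | ins v) m v).
    rewrite (partition_big (key e.+1) xpredT) //=; apply: eq_bigr => kap' _.
    by apply: eq_bigl => v; rewrite andbC.
  have -> : total_cnt m e.+1 = total_cnt m e + \sum_(v | ins v) m v.
    rewrite /total_cnt [X in _ + X]big_mkcond -big_split; apply: eq_bigr => v _ /=.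
    have := chainf_step e (cnt_chain v); have [_ f _ _] := cnt_chain v; have := f e.
    rewrite /ins; case: ltnP => h1 h2 h3.
      have -> : cnt v e.+1 = (cnt v e).+1 by lia.
      by rewrite mulnS addnC.
    have -> : cnt v e.+1 = cnt v e by lia.
    by rewrite addn0.
  by rewrite addKn.
have ni_eq kap' : ni u kap' = ni u' kap'.
  apply/eqP; apply: contraT => hne.
  have etn : \sum_kap ni u kap = \sum_kap ni u' kap by rewrite !tot_ni !etot.
  have [k2 lt2] : exists k2, ni u k2 < ni u' k2.
    by apply: exists_lt => //; exists kap'.
  have [k1 lt1] : exists k1, ni u' k1 < ni u k1.
    by apply: exists_lt => //; exists kap'; rewrite eq_sym.
  have [|v1 /andP[/eqP k1v1 i1] u1] :=
      @sum_gt0_ex u (fun v => (key e.+1 v == k1) && ins v).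
    by apply: leq_ltn_trans lt1.
  have [|v3 /andP[/eqP k2v3 i3] u3] :=
      @sum_gt0_ex u' (fun v => (key e.+1 v == k2) && ins v).
    by apply: leq_ltn_trans lt2.
  have [|v2 /andP[/eqP k1v2 i2] u2] :=
      @sum_gt0_ex u' (fun v => (key e.+1 v == k1) && ~~ ins v).
    by have := IH k1; rewrite !split_nk -/(no u' k1); lia.
  have [|v4 /andP[/eqP k2v4 i4] u4] :=
      @sum_gt0_ex u (fun v => (key e.+1 v == k2) && ~~ ins v).
    by have := IH k2; rewrite !split_nk -/(no u k2); lia.
  case: (@no_double_exchange e v1 v2 v3 v4) => //.
  - by apply/keyP; rewrite k1v1 k1v2.
  - by apply/keyP; rewrite k2v3 k2v4.
  - by move/keyP; rewrite k1v1 k2v3 => ek; move: lt1; rewrite ek; lia.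
  - by rewrite leqNgt.
  - by rewrite leqNgt.
  - by apply: tu => //; apply: contraTneq i1 => ->.
  - by apply: tu' => //; apply: contraTneq i3 => ->.
have no_eq kap' : no u kap' = no u' kap'.
  by have := IH kap'; rewrite !split_nk ni_eq => /addnI.
have [/existsP[w /eqP <-]|/existsPn nok] := boolP [exists w, key e w == kap]; last first.
  by rewrite /nk !big_pred0 // => v; apply/negbTE/nok.
have eq m : nk m e (key e w) =
    if ins w then ni m (key e.+1 w) else no m (key e.+1 w).
  have keyS v : (key e v == key e w) = (key e.+1 v == key e.+1 w) && (ins v == ins w).
    apply/eqP/andP => [/keyP[h1 h2]|[/eqP/keyP[h1 h2] /eqP h3]].
      split; last by rewrite /ins !h2.
      by apply/eqP/keyP; split=> // x hx; apply: h2; lia.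
    apply/keyP; split=> // x; rewrite leq_eqVlt => /orP[/eqP <-|/h2 //].
    have h4 := h2 e.+1 (leqnn _); move: h3; rewrite /ins h4.
    have := chainf_step e (cnt_chain v); have [_ f _ _] := cnt_chain v; have := f e.
    have := chainf_step e (cnt_chain w); have [_ g _ _] := cnt_chain w; have := g e.
    by rewrite h4; case: ltnP; case: ltnP; lia.
  by case hi: (ins w); apply: eq_bigl => v; rewrite keyS hi; case: (ins v).
by rewrite !eq; case: ifP => _.
Qed.

End Uniqueness.

(** * The multi-Rees algebra *)

Section ChainSeq.
Local Open Scope nat_scope.
Variables (c n : nat).

Definition gap : rel nat := fun x y => x + c < y.
Definition below (s : seq nat) x := count (fun y => y < x) s.
Definition jumps (f : nat -> nat) := [seq y <- iota 0 n | f y < f y.+1].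

Lemma gap_trans : transitive gap.
Proof. by move=> y x z; rewrite /gap; lia. Qed.

Lemma chainf_below s : sorted gap s -> all (fun y => y < n) s ->
  chainf c n (size s) (below s).
Proof.
elim: s => [|a s IH] //= hp /andP[an hs].
have [h0 h1 h2 h3] := IH (path_sorted hp) hs.
have {}hp : all (gap a) s by apply: (order_path_min gap_trans).
have z x : x <= a + c.+1 -> below s x = 0.
  move=> hx; apply/eqP; rewrite eqn0Ngt -has_count; apply/hasPn => y /(allP hp).
  by rewrite /gap; lia.
have below_cons x : below (a :: s) x = (a < x) + below s x by [].
split=> [|x|x|x hx]; rewrite !below_cons.
- by rewrite h0.
- by have := h1 x; lia.
- have := h2 x; case: (leqP x a) => hx; last by lia.
  by rewrite (z (x + c.+1)); lia.
- by rewrite h3 // (leq_trans an hx).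
Qed.

Lemma belowS s x : below s x.+1 = below s x + count_mem x s.
Proof.
rewrite /below; elim: s => //= a s ->; rewrite ltnS.
by case: (ltngtP a x) => /=; lia.
Qed.

Lemma below_jumps s : sorted gap s -> all (fun y => y < n) s -> s = jumps (below s).
Proof.
move=> hs hn; apply: (irr_sorted_eq ltn_trans ltnn).
- by apply: sub_sorted hs => x y; rewrite /gap; lia.
- by apply: sorted_filter; [exact: ltn_trans|exact: iota_ltn_sorted].
move=> y; rewrite mem_filter mem_iota /= add0n belowS -addn1 leq_add2l -has_count.
rewrite has_pred1; case ys : (y \in s) => //=.
by rewrite (allP hn).
Qed.

Lemma below_inj s s' : sorted gap s -> all (fun y => y < n) s ->
  sorted gap s' -> all (fun y => y < n) s' -> below s =1 below s' -> s = s'.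
Proof.
move=> h1 h2 h3 h4 e; rewrite (below_jumps h1 h2) (below_jumps h3 h4).
by apply: eq_filter => y; rewrite !e.
Qed.

Lemma jumps_all f : all (fun y => y < n) (jumps f).
Proof. by apply/allP => y; rewrite mem_filter mem_iota add0n => /andP[_]. Qed.

Lemma jumps_sorted T f : chainf c n T f -> sorted gap (jumps f).
Proof.
move=> hf; have [_ h1 h2 _] := hf.
apply: (@sub_in_sorted _ [pred y | f y < f y.+1] ltn).
- move=> x y; rewrite !inE => hx hy xy; rewrite /gap ltnNge; apply/negP => le.
  have := h2 x; have := chainf_mono (x := y.+1) (y := x + c.+1) hf.
  by have := chainf_mono (x := x.+1) (y := y) hf; lia.
- by apply/allP => y; rewrite mem_filter => /andP[].
- by apply: sorted_filter; [exact: ltn_trans|exact: iota_ltn_sorted].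
Qed.

Lemma below_jumpsK T f : chainf c n T f -> below (jumps f) =1 f.
Proof.
move=> hf x; have [f0 h1 h2 h3] := hf.
have key m : count (fun y => (y < x) && (f y < f y.+1)) (iota 0 m) = f (minn x m).
  elim: m => [|m IH]; first by rewrite minn0 f0.
  rewrite -addn1 iotaD count_cat IH add0n /= addn0.
  have := chainf_step m hf; have := h1 m.
  rewrite addn1; have [hm|hm] := ltnP m x.
    by rewrite (minn_idPr hm) /=; lia.
  by rewrite (minn_idPl (leqW hm)) addn0.
rewrite /below count_filter key; case: (leqP x n) => // h.
by rewrite !h3 // ltnW.
Qed.

Lemma size_jumps T f : chainf c n T f -> size (jumps f) = T.
Proof.
move=> hf; have [_ _ _ h3] := hf; rewrite -(h3 n) // -(below_jumpsK hf).
by apply/esym/eqP; rewrite -all_count jumps_all.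
Qed.

End ChainSeq.

(** * The presentation variables as chains, and the term order *)

Section ReesData.
Variables (K : fieldType) (n c k : nat) (t : 'I_k -> nat).
Hypothesis c_gt0 : (0 < c)%N.
Local Notation N := (rees_nvars n c t).

Definition var_poly (v : 'I_N) : {mpoly K[n]} :=
  match split (v : 'I_(n + #|{: rees_idx n c t}|)) with
  | inl i => 'X_i
  | inr r => chain_minor K (tagged (enum_val r))
  end.

Definition var_deg (v : 'I_N) : 'X_{1..k} :=
  match split (v : 'I_(n + #|{: rees_idx n c t}|)) with
  | inl i => 0%MM
  | inr r => U_(tag (enum_val r))%MM
  end.

(* The variables [x_i] are treated as chains of length one, of class [0]. *)
Definition var_class (v : 'I_N) : 'I_k.+1 :=
  match split (v : 'I_(n + #|{: rees_idx n c t}|)) with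
  | inl i => ord0
  | inr r => lift ord0 (tag (enum_val r))
  end.

Definition var_seq (v : 'I_N) : seq nat :=
  match split (v : 'I_(n + #|{: rees_idx n c t}|)) with
  | inl i => [:: nat_of_ord i]
  | inr r => map (@nat_of_ord n) (val (tagged (enum_val r)))
  end.

Definition class_len (d : 'I_k.+1) : nat :=
  if unlift ord0 d is Some j then t j else 1%N.

Definition var_cnt v := below (var_seq v).

Lemma rees_presE p : rees_pres p = graded_map var_poly var_deg p.
Proof.
rewrite /rees_pres /graded_map /mmap; apply: eq_bigr => u _; congr (_ * _).
apply: mmap1_eq => v; rewrite /rees_var /var_poly /var_deg.
by case: split => // i; rewrite mpolyX0 mulr1.
Qed.

Lemma var_seq_all v : all (fun y => y < n)%N (var_seq v).
Proof.
rewrite /var_seq; case: split => [i|r] /=; first by rewrite ltn_ord.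
by apply/allP => y /mapP[i _ ->].
Qed.

Lemma var_seq_sorted v : sorted (gap c) (var_seq v).
Proof.
rewrite /var_seq; case: split => [i|r] //.
by rewrite sorted_map; case: (tagged (enum_val r)) => a.
Qed.

Lemma var_seq_size v : size (var_seq v) = class_len (var_class v).
Proof.
rewrite /var_seq /class_len /var_class; case: split => [i|r]; first by rewrite unlift_none.
by rewrite liftK size_map size_tuple.
Qed.

Lemma var_cnt_chain v : chainf c n (class_len (var_class v)) (var_cnt v).
Proof.
by rewrite -var_seq_size; apply: chainf_below; [exact: var_seq_sorted|exact: var_seq_all].
Qed.

Lemma var_cnt_inj v w : var_class v = var_class w -> var_cnt v =1 var_cnt w -> v = w.
Proof.
move=> ec /(below_inj (var_seq_sorted v) (var_seq_all v) (var_seq_sorted w) (var_seq_all w)).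
move: ec; rewrite /var_class /var_seq => ec es; apply: (can_inj (@splitK n #|{: rees_idx n c t}|)).
move: ec es; case: (split (v : 'I_(n + _))) => [i|r]; case: (split (w : 'I_(n + _))) => [j|r'] //.
  by move=> _ [/val_inj ->].
move=> /lift_inj e1 e2; congr inr; apply: enum_val_inj.
move: e1 e2; case: (enum_val r) => j [a ha]; case: (enum_val r') => j' [a' ha'] /= e.
case: j' / e a' ha' => a' ha' /(inj_map val_inj) /val_inj e.
by case: a' / e ha' => ha'; rewrite (bool_irrelevance ha ha').
Qed.

Lemma var_cnt_surj d f : chainf c n (class_len d) f ->
  exists v, var_class v = d /\ var_cnt v =1 f.
Proof.
move=> hf; have hs := size_jumps hf; have hg := jumps_sorted hf.
have ha := jumps_all n f.
suff [v [h1 h2]] : exists v, var_class v = d /\ var_seq v = jumps n f.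
  by exists v; split=> // x; rewrite /var_cnt h2 (below_jumpsK hf).
move: hs; rewrite /class_len; case: unliftP => [j ->|->] hs.
  pose s : seq 'I_n := pmap insub (jumps n f).
  have es : map val s = jumps n f.
    rewrite pmap_filter; last exact: insubK.
    by apply/all_filterP; apply: sub_all ha => y hy; rewrite /= insubT.
  have sz : size s == t j by rewrite -(size_map val) es hs.
  have hch : is_cchain c (Tuple sz).
    by rewrite /is_cchain; move: hg; rewrite -es sorted_map.
  pose ja : rees_idx n c t := Tagged (fun j => cchain n c (t j))
    (exist _ (Tuple sz) hch : cchain n c (t j)).
  exists (unsplit (inr (enum_rank ja)) : 'I_N).
  by rewrite /var_class /var_seq unsplitK enum_rankK /=.
case: (jumps n f) hs ha => // y [|//] _ /andP[/= hy _].
exists (unsplit (inl (Ordinal hy)) : 'I_N).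
by rewrite /var_class /var_seq unsplitK.
Qed.

Lemma chain_minorE l (a : cchain n c l) :
  chain_minor K a = gminor K n c (fun i : 'I_l => i) (fun j => chain_col a j).
Proof.
congr determinant; apply/matrixP => i j; rewrite !mxE -nvar_ord /=.
by rewrite addnC.
Qed.

Lemma chain_col_range l (a : cchain n c l) :
  in_range n c (fun i : 'I_l => i) (fun j => chain_col a j).
Proof. by move=> i j; rewrite addnC; apply: catalecticant_subproof. Qed.

Lemma chain_col_strict l (a : cchain n c l) : strict (fun j => chain_col a j).
Proof.
clear c_gt0; move=> i j h /=; have -> : (j * c = i * c + (j - i) * c)%N.
  by rewrite -mulnDl subnKC // ltnW.
have key (x y p q : nat) : (p <= x -> x + q < y -> x - p < y - (p + q))%N by lia.
exact: key (cchain_geq a i) (cchain_leq a h).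
Qed.

Lemma id_strict l : strict (fun i : 'I_l => (i : nat)).
Proof. by []. Qed.

Lemma var_poly_minor v : minors c (class_len (var_class v)) (var_poly v).
Proof.
rewrite /var_poly /class_len /var_class; case: split => [i|r].
  rewrite unlift_none; exists (fun=> 0%N), (fun=> nat_of_ord i); split.
  - by move=> x y; rewrite !ord1.
  - by move=> x y; rewrite !ord1.
  - by move=> x y; rewrite mul0n add0n.
  - by rewrite /gminor det_mx11 mxE mul0n add0n nvar_ord.
rewrite liftK chain_minorE.
exists (fun i => nat_of_ord i), (fun j => chain_col (tagged (enum_val r)) j); split=> //.
- exact: chain_col_strict.
- exact: chain_col_range.
Qed.

Lemma pcountD (m1 m2 : 'X_{1..n}) x : pcount (m1 + m2)%MM x = (pcount m1 x + pcount m2 x)%N.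
Proof. by rewrite /pcount -big_split; apply: eq_bigr => y _; rewrite evD. Qed.

Lemma pcount_inj (m1 m2 : 'X_{1..n}) : pcount m1 =1 pcount m2 -> m1 = m2.
Proof.
move=> e; apply/mnmP => i; rewrite -!ev_ord.
by have := e i.+1; rewrite !pcountS e => /addnI.
Qed.

Lemma pcount0 x : pcount (0%MM : 'X_{1..n}) x = 0%N.
Proof. by rewrite /pcount big1 // => y _; rewrite ev0. Qed.

Lemma pcountU (i : 'I_n) x : pcount U_(i)%MM x = (i < x)%N.
Proof.
elim: x => [|x IH]; first by rewrite /pcount big_geq.
rewrite pcountS IH -nX_ord ev_nX // ltnS.
by case: (ltngtP i x).
Qed.

Lemma mlead_var_poly v x : pcount (mlead (var_poly v)) x = var_cnt v x.
Proof.
rewrite /var_poly /var_cnt /var_seq; case: split => [i|r].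
  by rewrite mleadXm pcountU /below /= addn0.
set a := tagged (enum_val r); rewrite chain_minorE.
have [-> _] := gminor_lead K c_gt0 (@id_strict _) (@chain_col_strict _ a)
  (@chain_col_range _ a).
have -> : diag_mnm n c (fun i : 'I_(t (tag (enum_val r))) => i) (fun j => chain_col a j) 1%g =
    (\sum_(i <- val a) U_(i))%MM.
  rewrite big_tuple /diag_mnm; apply: eq_bigr => i _; rewrite perm1 /=.
  by rewrite subnKC ?cchain_geq // nX_ord.
rewrite /below count_map; elim: (tval (val a)) => [|y s IH].
  by rewrite big_nil pcount0.
by rewrite big_cons pcountD pcountU IH.
Qed.

Lemma minors_monic l p : minors (K := K) (n := n) c l p -> p@_(mlead p) = 1.
Proof.
case=> f [g [hf hg hr ->]].
by have [-> ] := gminor_lead K c_gt0 hf hg hr.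
Qed.

Local Notation F u := (initial_map var_poly 'X_[u]).
Local Notation mu := (fun u => mlead (initial_map var_poly 'X_[u])).

Lemma initial_mapU v : F U_(v)%MM = var_poly v.
Proof. by rewrite /initial_map mmapX mmap1U. Qed.

Lemma initial_mapM u w : F (u + w)%MM = F u * F w.
Proof. by rewrite mpolyXD rmorphM. Qed.

Lemma F_monic u : (F u)@_(mu u) = 1.
Proof.
elim/mnm_ind: u => [|v u IH] /=; first by rewrite mpolyX0 rmorph1 mleadc1.
have h := minors_monic (var_poly_minor v).
have nz : (F U_(v)%MM)@_(mlead (F U_(v)%MM)) * (F u)@_(mlead (F u)) != 0.
  by rewrite initial_mapU h IH mulr1 oner_eq0.
by rewrite initial_mapM mleadM_proper // mleadcM IH initial_mapU h mulr1.
Qed.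

Lemma muD u w : mu (u + w)%MM = (mu u + mu w)%MM.
Proof.
by rewrite /= initial_mapM mleadM_proper // !F_monic mulr1 oner_eq0.
Qed.

Lemma muU v : mu U_(v)%MM = mlead (var_poly v).
Proof. by rewrite /= initial_mapU. Qed.

Lemma pcount_mu u x : pcount (mu u) x = total_cnt var_cnt u x.
Proof.
elim/mnm_ind: u => [|v u IH] /=.
  by rewrite mpolyX0 rmorph1 mlead1 pcount0 /total_cnt big1 // => w _; rewrite mnm0E.
rewrite muD pcountD IH initial_mapU mlead_var_poly /total_cnt.
under [RHS]eq_bigr => w _ do rewrite mnmDE mulnDl.
rewrite big_split; congr (_ + _)%N; rewrite (bigD1 v) //= mnm1E eqxx mul1n.
by rewrite big1 ?addn0 // => w hw; rewrite mnm1E eq_sym (negbTE hw).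
Qed.

Definition nat_weight (w : 'I_N -> nat) (u : 'X_{1..N}) : nat := (\sum_v u v * w v)%N.

Lemma nat_weightD w u u' :
  nat_weight w (u + u')%MM = (nat_weight w u + nat_weight w u')%N.
Proof.
rewrite /nat_weight -big_split; apply: eq_bigr => v _ /=.
by rewrite mnmDE mulnDl.
Qed.

Lemma nat_weightU w v : nat_weight w U_(v)%MM = w v.
Proof.
rewrite /nat_weight (bigD1 v) //= mnm1E eqxx mul1n big1 ?addn0 // => i hi.
by rewrite mnm1E eq_sym (negbTE hi).
Qed.

(** The keys need not separate monomials; the innermost monomial order makes the relation
    antisymmetric. *)
Definition rees_order : rel 'X_{1..N} :=
  refine_order mu
    (refine_order (nat_weight (w_square n var_cnt))
      (refine_order (nat_weight (w_class n var_class var_cnt))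
        (refine_order (nat_weight (w_spread n var_cnt))
          (fun u v => (u <= v)%O)))).

Lemma nat_weight_term_order w le : term_order le ->
  term_order (refine_order (nat_weight w) le).
Proof.
move=> h; apply: refine_term_order => // [u|x u v].
  by rewrite leEnat /nat_weight big1 // => v _; rewrite mnm0E.
by rewrite !ltEnat /= !nat_weightD ltn_add2r.
Qed.

Lemma rees_term_order : term_order rees_order.
Proof.
apply: refine_term_order => [|u|w u v].
- do 3 apply: nat_weight_term_order; exact: mnmc_term_order.
- by rewrite /= mpolyX0 rmorph1 mlead1 le0x.
- by rewrite !muD ltmc_add2l.
Qed.

Local Notation clw := (mnm_weight (fun v => U_(var_class v)%MM)).
Local Notation beta := (mnm_weight var_deg).

Lemma beta_clw u j : beta u j = clw u (lift ord0 j).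
Proof.
rewrite !mnm_sumE; apply: eq_bigr => v _; rewrite !mulmnE; congr (_ * _)%N.
rewrite /var_deg /var_class; case: split => [i|r]; first by rewrite mnm0E mnm1E.
by rewrite !mnm1E (inj_eq lift_inj).
Qed.

Lemma clw_beta u v : clw u = clw v -> beta u = beta v.
Proof. by move=> e; apply/mnmP => j; rewrite !beta_clw e. Qed.

Lemma mdeg_clw u : mdeg (clw u) = mdeg u.
Proof.
rewrite /mnm_weight [RHS]mdegE.
transitivity (\sum_v mdeg (U_(var_class v) *+ u v)%MM)%N.
  by elim/big_rec2: _ => [|i a b _ <-]; rewrite ?mdeg0 ?mdegD.
by apply: eq_bigr => v _; rewrite mdegMn mdeg1 mul1n.
Qed.

Lemma clw_mdeg u v : clw u = clw v -> mdeg u = mdeg v.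
Proof. by rewrite -!mdeg_clw => ->. Qed.

Lemma mdeg_mu u : mdeg (mu u) = (\sum_d class_len d * clw u d)%N.
Proof.
rewrite -(@pcount_mdeg _ _ n) // pcount_mu /total_cnt.
under [RHS]eq_bigr => d _ do rewrite mnm_sumE big_distrr /=.
rewrite exchange_big; apply: eq_bigr => v _ /=.
have [_ _ _ h] := var_cnt_chain v; rewrite h //.
rewrite (bigD1 (var_class v)) //= mulmnE mnm1E eqxx mul1n mulnC big1 ?addn0 // => d hd.
by rewrite mulmnE mnm1E eq_sym (negbTE hd) muln0.
Qed.

(** The [T]-degree counts the factors of every class except 0. The number of factors [x_i] is then
    read off the degree of [mu], each of them having length one. *)
Lemma clw_inj u v : beta u = beta v -> mu u = mu v -> clw u = clw v.
Proof.
move=> eb em; have el j : clw u (lift ord0 j) = clw v (lift ord0 j) by rewrite -!beta_clw eb.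
apply/mnmP => d; case: (unliftP ord0 d) => [j ->|->]; first exact: el.
have := congr1 (@mdeg n) em; rewrite !mdeg_mu !big_ord_recl.
have -> : class_len ord0 = 1%N by rewrite /class_len unlift_none.
rewrite !mul1n; under eq_bigr do rewrite el.
exact: addIn.
Qed.

Lemma mdeg2P (q : 'X_{1..N}) : mdeg q = 2 -> exists v w, q = (U_(v) + U_(w))%MM.
Proof.
move=> h; have q0 : q != 0%MM by rewrite -mdeg_eq0 h.
have [v hv] : exists v, q v != 0%N.
  apply/existsP; apply: contraR q0 => /existsPn hn; apply/eqP/mnmP => i.
  by rewrite mnm0E; apply/eqP; have := hn i; rewrite negbK.
have hq : (U_(v) <= q)%MM by rewrite lep1mP.
have : mdeg (q - U_(v))%MM = 1%N.
  by apply/eqP; rewrite -(eqn_add2r (mdeg U_(v)%MM)) -mdegD submK // h mdeg1.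
move/eqP/mdeg1P => [w /eqP e]; exists w, v; by rewrite -e submK.
Qed.

(** A better pair has the same classes and the same content, hence the same [mu]. The weights in
    [better] are, in this order, the keys of [rees_order] after [mu], so it improves a quadratic
    divisor of [u]. *)
Lemma standard_tight u :
  standard var_poly (fun v => U_(var_class v)%MM) rees_order u ->
  all_tight n var_class var_cnt u.
Proof.
move=> su v w nvw uv uw v' w' cv cw ecnt hb.
have hq : (U_(v) + U_(w) <= u)%MM.
  apply/mnm_lepP => i; rewrite mnmDE !mnm1E.
  have [e1|] := eqVneq v i; have [e2|] := eqVneq w i; try lia.
  - by move: nvw; rewrite e1 e2 eqxx.
  - by rewrite -e1; lia.
  - by rewrite -e2; lia.
have := su _ hq; rewrite mdegD !mdeg1 => /(_ erefl)/negP; apply.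
apply/(improvableP _ _ clw_mdeg).
have emu : mu (U_(v') + U_(w'))%MM = mu (U_(v) + U_(w))%MM.
  by apply: pcount_inj => x; rewrite !muD !pcountD !muU !mlead_var_poly ecnt.
exists (U_(v') + U_(w'))%MM; split.
- by rewrite !mnm_weightD !mnm_weightU cv cw.
- exact: emu.
- apply/eqP => eq; have wt w0 := congr1 (nat_weight w0) eq.
  have := wt (w_square n var_cnt); have := wt (w_class n var_class var_cnt).
  have := wt (w_spread n var_cnt); rewrite !nat_weightD !nat_weightU.
  by case: hb => [|[]|[]]; lia.
rewrite /rees_order refine_order_eq //; case: hb => [h|[h1 h2]|[h1 h2 h3]].
- by apply: refine_order_lt; rewrite ltEnat /= !nat_weightD !nat_weightU.
- rewrite refine_order_eq ?nat_weightD ?nat_weightU //.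
  by apply: refine_order_lt; rewrite ltEnat /= !nat_weightD !nat_weightU.
- rewrite refine_order_eq ?nat_weightD ?nat_weightU //.
  rewrite refine_order_eq ?nat_weightD ?nat_weightU //.
  by apply: refine_order_lt; rewrite ltEnat /= !nat_weightD !nat_weightU.
Qed.

Lemma standard_injective u v :
  standard var_poly (fun v => U_(var_class v)%MM) rees_order u ->
  standard var_poly (fun v => U_(var_class v)%MM) rees_order v ->
  beta u = beta v -> mu u = mu v -> u = v.
Proof.
move=> /standard_tight su /standard_tight sv eb em.
apply: (tight_unique var_cnt_chain var_cnt_inj var_cnt_surj su sv).
  exact: clw_inj.
by move=> x; rewrite -!pcount_mu em.
Qed.

Lemma gminor_homog l (f g : 'I_l -> nat) : in_range n c f g ->
  gminor K n c f g \is l.-homog.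
Proof.
move=> hr; rewrite gminorE //; apply: rpred_sum => s _; apply: rpredZ.
rewrite dhomogX; apply/eqP; rewrite /diag_mnm /= mdeg_sum.
rewrite (eq_bigr (fun=> 1%N)) ?sum1_card ?card_ord //.
by move=> i _; rewrite -[(_ + _)%N]/(nat_of_ord (Ordinal (hr i (s i)))) nX_ord mdeg1.
Qed.

Lemma U2_eq (d : nat) (a b x y : 'I_d) : (U_(a) + U_(b) = U_(x) + U_(y))%MM ->
  (a = x /\ b = y) \/ (a = y /\ b = x).
Proof.
move=> /mnmP e; have := e a; have := e b; rewrite !mnmDE !mnm1E !eqxx.
have [<-|na] := eqVneq x a.
  have [<-|nb] := eqVneq y b; first by left.
  by have [<-|] := eqVneq y x; case: eqP => //; lia.
have [<-|nb] := eqVneq y a; last by lia.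
by have [<-|] := eqVneq x b; [right|case: eqP => //; lia].
Qed.

Lemma sagbi_pairs q r : mdeg q = 2 ->
  (forall s, s \in msupp r -> clw s = clw q) -> initial_map var_poly r != 0 ->
  exists s, clw s = clw q /\ mlead (initial_map var_poly r) = mu s.
Proof.
move=> /mdeg2P[v0 [w0 q0]] hr nz; rewrite q0 in hr *.
(* Sorted by length, so that ideal membership is recorded for the longer factor, the stronger
   condition. *)
have [v [w [cq hle]]] : exists v w,
    clw (U_(v0) + U_(w0))%MM = (U_(var_class v) + U_(var_class w))%MM /\
    (class_len (var_class v) <= class_len (var_class w))%N.
  have [h|h] := leqP (class_len (var_class v0)) (class_len (var_class w0)).
    by exists v0, w0; rewrite mnm_weightD !mnm_weightU.
  by exists w0, v0; rewrite mnm_weightD !mnm_weightU addmC; split=> //; apply: ltnW.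
set f := initial_map var_poly r in nz *.
have supp s : s \in msupp r -> exists a b, [/\ F s = var_poly a * var_poly b,
    var_class a = var_class v & var_class b = var_class w].
  move=> sr; have := hr s sr.
  have /mdeg2P[a [b ->]] : mdeg s = 2 by rewrite (clw_mdeg (hr s sr)) mdegD !mdeg1.
  rewrite cq mnm_weightD !mnm_weightU => /U2_eq[[h1 h2]|[h1 h2]].
    by exists a, b; rewrite initial_mapM !initial_mapU.
  by exists b, a; rewrite initial_mapM !initial_mapU mulrC.
have fE : f = \sum_(s <- msupp r) r@_s *: F s by rewrite /f initial_mapE.
have hJ : Jideal c (class_len (var_class w)) f.
  rewrite fE; apply: ideal_sum => [|s /supp[a [b [-> _ cb]]]]; first exact: ideal_gen_ideal.
  have [_ _ JM] := ideal_gen_ideal (@minors K n c (class_len (var_class w))).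
  rewrite -mul_mpolyC; apply: (JM); apply: JM; apply: ideal_gen_incl.
  by rewrite -cb; apply: var_poly_minor.
have hU : udeg_le 2 (shift c f).
  rewrite fE (raddf_sum (shift c)) big_seq /=.
  elim/big_ind: _ => [m|x y hx hy|s /supp[a [b [-> _ _]]]]; first by rewrite msupp0.
    exact: udeg_leD.
  rewrite shiftZ rmorphM /= -[2%N]/(0 + (1 + 1))%N; apply: udeg_leM; first exact: udeg_leC.
  have [f1 [g1 [_ _ hr1 ->]]] := var_poly_minor a.
  have [f2 [g2 [_ _ hr2 ->]]] := var_poly_minor b.
  by apply: udeg_leM; apply: udeg_shift_gminor.
have hd : mdeg (mlead f) = (class_len (var_class v) + class_len (var_class w))%N.
  have : f \is (class_len (var_class v) + class_len (var_class w)).-homog.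
    rewrite fE big_seq; apply: rpred_sum => s /supp[a [b [-> <- <-]]]; apply: rpredZ.
    have [f1 [g1 [_ _ hr1 ->]]] := var_poly_minor a.
    have [f2 [g2 [_ _ hr2 ->]]] := var_poly_minor b.
    by apply: dhomogM; apply: gminor_homog.
  by move/dhomogP; apply; apply: mlead_supp.
have [f1 [f2 [/var_cnt_surj[a [ca ha]] /var_cnt_surj[b [cb hb]] h3]]] :=
  lead_two_chains c_gt0 hle nz hJ hU hd.
exists (U_(a) + U_(b))%MM; split; first by rewrite cq mnm_weightD !mnm_weightU ca cb.
apply: pcount_inj => x; rewrite muD pcountD !muU !mlead_var_poly.
by rewrite ha hb h3.
Qed.

Theorem rees_groebner_basis : exists G : seq {mpoly K[N]},
  groebner_basis rees_order (fun p => graded_map var_poly var_deg p = 0) G /\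
  (forall g, g \in G -> g \is 2.-homog).
Proof.
apply: (@quadratic_groebner_basis K N n k k.+1 var_poly var_deg
  (fun v => U_(var_class v)%MM) rees_order rees_term_order).
- by move=> u v; apply: refine_order_key.
- by move=> u v; apply: refine_order_lt.
- exact: F_monic.
- exact: clw_beta.
- exact: clw_mdeg.
- exact: sagbi_pairs.
- exact: standard_injective.
Qed.

End ReesData.

(** Thus a [t]-minor of [X_t] involves all rows in order. A strictly increasing self-map satisfies
    [i <= f i]; conjugation by [rev_ord] gives the reverse inequality. *)
Lemma strict_id t (f : 'I_t -> 'I_t) : {homo f : i j / (i < j)%N} -> f =1 id.
Proof.
have ge (g : 'I_t -> 'I_t) : {homo g : i j / (i < j)%N} -> forall i : 'I_t, (i <= g i)%N.
  move=> hg [i hi]; elim: i hi => [|i IH] hi //=.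
  by apply: leq_ltn_trans (IH (ltnW hi)) _; apply: hg.
move=> hf i; apply: val_inj; apply/eqP; rewrite eqn_leq (ge f hf i) andbT.
have := ge (@rev_ord t \o f \o @rev_ord t) _ (rev_ord i); rewrite /= rev_ordK.
have hfi := ltn_ord (f i); have hi := ltn_ord i.
suff h : {homo (@rev_ord t \o f \o @rev_ord t) : i j / (i < j)%N}.
  by move=> /(_ h); lia.
move=> x y xy /=; have hxy : (rev_ord y < rev_ord x)%N.
  by rewrite /=; have := ltn_ord x; have := ltn_ord y; lia.
by have := hf _ _ hxy; have := ltn_ord (f (rev_ord x)); have := ltn_ord (f (rev_ord y)); lia.
Qed.

(** * The image of the presentation is the multi-Rees algebra *)

Section ReesImage.
Variables (K : fieldType) (n c k : nat) (t : 'I_k -> nat).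
Local Notation N := (rees_nvars n c t).
Local Notation vpoly := (@var_poly K n c k t).
Local Notation vdeg := (@var_deg n c k t).
Local Notation phi := (graded_map vpoly vdeg).
Local Notation L j := (minor_ideal (K := K) (n := n) c (t j)).
Local Notation RT := {mpoly {mpoly K[n]}[k]}.

Definition in_image al (a : {mpoly K[n]}) : Prop := exists p, phi p = a%:MP * 'X_[al].

Lemma phiU v : phi 'X_v = (vpoly v)%:MP * 'X_[vdeg v].
Proof. by rewrite /graded_map mmapX mmap1U. Qed.

Lemma in_imageD al a b : in_image al a -> in_image al b -> in_image al (a + b).
Proof. by case=> p hp [q hq]; exists (p + q); rewrite raddfD /= hp hq mpolyCD mulrDl. Qed.

Lemma in_imageM al be a b : in_image al a -> in_image be b -> in_image (al + be)%MM (a * b).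
Proof.
by case=> p hp [q hq]; exists (p * q); rewrite rmorphM /= hp hq mpolyCM mpolyXD mulrACA.
Qed.

Lemma in_image_var v : in_image (vdeg v) (vpoly v).
Proof. by exists 'X_v; rewrite phiU. Qed.

Lemma in_image0 (r : {mpoly K[n]}) : in_image 0%MM r.
Proof.
have imC a : in_image 0%MM a%:MP.
  by exists a%:MP; rewrite /graded_map mmapC mpolyX0 mulr1.
rewrite [r]mpolyE; elim/big_ind: _ => [|x y|m _]; first by rewrite -mpolyC0; apply: imC.
  exact: in_imageD.
rewrite -mul_mpolyC -[0%MM]addm0; apply: in_imageM; first exact: imC.
elim/mnm_ind: m => [|i m IH]; first by rewrite mpolyX0; apply: imC.
rewrite mpolyXD -[0%MM]addm0; apply: in_imageM => //.
have := in_image_var (unsplit (inl i) : 'I_N).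
by rewrite /var_deg /var_poly unsplitK.
Qed.

Lemma in_image_ideal al : is_ideal (in_image al).
Proof.
split; [by exists 0; rewrite raddf0 mpolyC0 mul0r|exact: in_imageD|].
by move=> r a h; rewrite -[al]add0m; apply: in_imageM => //; apply: in_image0.
Qed.

Lemma in_image_mul I J al be :
  (forall a, I a -> in_image al a) -> (forall a, J a -> in_image be a) ->
  forall a, ideal_mul I J a -> in_image (al + be)%MM a.
Proof.
move=> hI hJ; apply: ideal_gen_sub; first exact: in_image_ideal.
by move=> _ [x [y [/hI hx /hJ hy ->]]]; apply: in_imageM.
Qed.

(** The chain is the list of indices on the diagonal: adding [i * c] to the column [g i] turns
    strict increase into gaps larger than [c]. *)
Lemma minor_is_chain_minor l (d : {mpoly K[n]}) : is_minor l (cat_mx K n c l) d ->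
  exists a : cchain n c l, chain_minor K a = d.
Proof.
case=> f [g [/strict_id hf hg ->]].
pose a : l.-tuple 'I_n := [tuple Ordinal (catalecticant_subproof i (g i)) | i < l].
have ha : is_cchain c a.
  rewrite /is_cchain; have [l0|lp] := posnP l.
    by have /size0nil -> : size a = 0%N by rewrite size_tuple.
  have x0 := tnth a (Ordinal lp).
  apply/(sortedP x0) => i; rewrite size_tuple => hi.
  have hi' : (i < l)%N by apply: ltnW.
  have e m (hm : (m < l)%N) : nth x0 a m =
      Ordinal (catalecticant_subproof (Ordinal hm) (g (Ordinal hm))).
    by rewrite -[m]/(nat_of_ord (Ordinal hm)) -tnth_nth tnth_mktuple.
  have := hg (Ordinal hi') (Ordinal hi) (ltnSn i).
  by rewrite (e _ hi) (e _ hi') /= mulSn; lia.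
exists (exist _ a ha); congr determinant; apply/matrixP => i j; rewrite !mxE hf.
congr 'X_[U_(_)]; apply: val_inj => /=; congr (_ + _)%N.
by rewrite tnth_mktuple /= addnK.
Qed.

Lemma in_image_minor j a : L j a -> in_image U_(j)%MM a.
Proof.
move: a; apply: ideal_gen_sub; first exact: in_image_ideal.
move=> d /minor_is_chain_minor[a <-].
pose ja : rees_idx n c t := Tagged (fun j => cchain n c (t j)) a.
have := in_image_var (unsplit (inr (enum_rank ja)) : 'I_N).
by rewrite /var_deg /var_poly unsplitK enum_rankK.
Qed.

Definition power_product (r : seq 'I_k) (al : 'X_{1..k}) : {mpoly K[n]} -> Prop :=
  \big[@ideal_mul _/@ideal_one _]_(j <- r) ideal_exp (L j) (al j).

Lemma in_image_product r al a : power_product r al a ->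
  in_image (\sum_(j <- r) U_(j) *+ al j)%MM a.
Proof.
have hexp j d : forall b, ideal_exp (L j) d b -> in_image (U_(j) *+ d)%MM b.
  elim: d => [|d IH] b; first by rewrite mulm0n => _; apply: in_image0.
  by rewrite mulmS; apply: in_image_mul => // x; apply: in_image_minor.
rewrite /power_product; elim: r a => [|j r IH] a.
  by rewrite !big_nil => _; apply: in_image0.
rewrite !big_cons; apply: in_image_mul; [exact: hexp|exact: IH].
Qed.

Lemma power_product_ideal r al : is_ideal (power_product r al).
Proof.
rewrite /power_product; elim: r => [|j r _]; first by rewrite big_nil; split.
by rewrite big_cons; apply: ideal_gen_ideal.
Qed.

Lemma power_product1 r : power_product r 0%MM 1.
Proof.
rewrite /power_product; elim: r => [|j r IH]; first by rewrite big_nil.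
rewrite big_cons; apply: ideal_gen_incl; exists 1, 1; rewrite mulr1.
by split=> //; rewrite mnm0E.
Qed.

(** As [j] occurs once in [r], a single factor absorbs [m] and the others keep their exponents. *)
Lemma power_product_mul r al j m a : uniq r -> j \in r -> L j m ->
  power_product r al a -> power_product r (U_(j) + al)%MM (m * a).
Proof.
rewrite /power_product => + + hm; elim: r a => [//|i r IH] a /= /andP[ir ur].
rewrite inE !big_cons => hj.
set I' := ideal_mul (ideal_exp (L i) ((U_(j) + al)%MM i)) _.
have [J0 JD JM] : is_ideal I' by apply: ideal_gen_ideal.
move: a; apply: (@ideal_gen_sub _ _ (fun a => I' (m * a))).
  split; first by rewrite mulr0.
    by move=> x y hx hy; rewrite mulrDr; apply: JD.
  by move=> b x hx; rewrite mulrCA; apply: JM.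
move=> _ [x [y [hx hy ->]]]; apply: ideal_gen_incl.
have [eij|nij] := eqVneq j i.
  subst i; exists (m * x), y; rewrite mulrA; split=> //.
    rewrite mnmDE mnm1E eqxx; apply: ideal_gen_incl; by exists m, x.
  rewrite (eq_big_seq (fun i => ideal_exp (L i) (al i))) // => i hi.
  rewrite mnmDE mnm1E; case: eqP => // e; by rewrite e hi in ir.
exists x, (m * y); rewrite mulrCA; split=> //.
  by rewrite mnmDE mnm1E (negbTE nij).
by apply: IH => //; rewrite (negbTE nij) in hj.
Qed.

Lemma chain_minor_in l (a : cchain n c l) : minor_ideal c l (chain_minor K a).
Proof.
apply: ideal_gen_incl; exists id, (chain_col a); split=> //.
exact: chain_col_strict.
Qed.

Lemma power_product_F u :
  power_product (index_enum 'I_k) (mnm_weight vdeg u) (initial_map vpoly 'X_[u]).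
Proof.
elim/mnm_ind: u => [|v u IH].
  rewrite mpolyX0 rmorph1 (_ : mnm_weight _ _ = 0%MM); first exact: power_product1.
  by apply/mnmP => j; rewrite mnm_sumE mnm0E big1 // => i _; rewrite mulmnE mnm0E muln0.
rewrite initial_mapM initial_mapU mnm_weightD mnm_weightU.
have [_ _ JM] := power_product_ideal (index_enum 'I_k) (mnm_weight vdeg u).
rewrite {1}/var_poly {1}/var_deg; case: split => [i|r].
  by rewrite add0m; apply: JM.
apply: power_product_mul IH; first exact: index_enum_uniq.
  exact: mem_index_enum.
exact: chain_minor_in.
Qed.

Theorem rees_image (f : RT) :
  rees (fun j => L j) f <-> exists p : {mpoly K[N]}, rees_pres p = f.
Proof.
split=> [h|[p <-] al].
  suff [p hp] : exists p, phi p = f by exists p; rewrite rees_presE.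
  rewrite [f]mpolyE; elim/big_ind: _ => [|x y [p <-] [q <-]|al _].
  - by exists 0; rewrite raddf0.
  - by exists (p + q); rewrite raddfD.
  - have [p hp] := in_image_product (h al); exists p; rewrite hp mul_mpolyC.
    by rewrite -multinomUE_id.
rewrite rees_presE mcoeff_graded_map.
have hI := power_product_ideal (index_enum 'I_k) al.
rewrite big_mkcond; apply: (ideal_sum hI) => u _; case: eqP => [<-|_]; last by case: hI.
rewrite -mul_mpolyC.
have [_ _ JM] := power_product_ideal (index_enum 'I_k) (mnm_weight vdeg u).
apply: JM; exact: power_product_F.
Qed.

End ReesImage.

Lemma groebner_basis_ext (K : fieldType) N (le : rel 'X_{1..N})
    (I J : {mpoly K[N]} -> Prop) G :
  (forall p, I p <-> J p) -> groebner_basis le I G -> groebner_basis le J G.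
Proof.
move=> IJ [nz inI ini]; split=> [//|g /inI /IJ //|p].
split=> [[s [hs ->]]|/ini[s [hs ->]]]; [apply/ini|]; exists s; split=> // u;
  by move=> /hs[f [m [hf lf e]]]; exists f, m; split=> //; apply/IJ.
Qed.

Theorem theorem5p13 (K : fieldType) (n c k : nat) (t : 'I_k -> nat)
    (hn : (1 <= n)%N) (hc : (1 <= c)%N)
    (ht : forall j : 'I_k, (1 <= t j <= (n + c) %/ (c + 1))%N) :
  (forall f : {mpoly {mpoly K[n]}[k]},
      rees (fun j : 'I_k => minor_ideal (K := K) (n := n) c (t j)) f <->
      exists p : {mpoly K[rees_nvars n c t]}, rees_pres p = f) /\
  (exists (le : rel 'X_{1..rees_nvars n c t})
          (G : seq {mpoly K[rees_nvars n c t]}),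
      [/\ term_order le,
          groebner_basis le
            (fun p : {mpoly K[rees_nvars n c t]} => rees_pres p = 0) G
        & forall g, g \in G -> g \is 2.-homog]).
Proof.
split=> [f|]; first exact: rees_image.
have [G [hG homG]] := @rees_groebner_basis K n c k t hc.
exists (@rees_order K n c k t), G; split; last exact: homG.
  exact: rees_term_order.
by apply: groebner_basis_ext hG => p; rewrite rees_presE.
Qed.
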